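(* Let $q \equiv 1 \pmod 4$ be a prime power, let $\chi_4\in\widehat{\mathbb{F}_q^*}$ be a character of order $4$, and let $A\in\widehat{\mathbb{F}_q^*}$ with $A^8 \neq \varepsilon$. Then $${}_{6}F_{6}\left( \begin{array}{cccccc} \chi_4, & \overline{\chi_4}, & \chi_4 A, & \overline{\chi_4} A, & \chi_4 \overline{A}, & \overline{\chi_4 A}\\ \varepsilon, & \varphi, & \overline{A}, & \varphi \overline{A}, & A, & \varphi A \end{array} \Big| \; 1 \right)_{q} = 1 +\sum_{R^2=\varphi} \frac{ g(\overline{R}\varphi A^2) \, g(\overline{R}\varphi \overline{A}^2) }{g(\overline{R})^2} + E,$$ where $$E=\begin{cases} \displaystyle\sum_{S^2=\chi_4} \frac{ g(SA) \, g(\chi_4 SA)}{g(\varphi SA) \, g(\overline{\chi_4} SA)} & \text{if } q \equiv 1 \pmod 8,\\ 0 & \text{otherwise},\end{cases}$$ and the sums are over all $R\in\widehat{\mathbb{F}_q^*}$ with $R^2=\varphi$ and all $S\in\widehat{\mathbb{F}_q^*}$ with $S^2=\chi_4$, respectively.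
   Context: $\mathbb{F}_q$ is the finite field with $q$ elements and $\widehat{\mathbb{F}_q^*}$ the group of (complex) multiplicative characters of $\mathbb{F}_q^*$; every $\chi\in\widehat{\mathbb{F}_q^*}$, including the trivial character $\varepsilon$, is extended to $\mathbb{F}_q$ by $\chi(0):=0$; $\overline{\chi}$ is the inverse of $\chi$; $\varphi$ is the character of order two. Fix a non-trivial additive character $\theta$ of $\mathbb{F}_q$ and define the Gauss sum $g(\chi):=\sum_{x\in\mathbb{F}_q}\chi(x)\theta(x)$. For $A_i,B_i\in\widehat{\mathbb{F}_q^*}$ and $\lambda\in\mathbb{F}_q$, $${}_{m}F_{m}\left( \begin{array}{ccc} A_1, & \dots, & A_m \\ B_1, & \dots, & B_m \end{array} \Big| \; \lambda \right)_{q} := \frac{-1}{q-1} \sum_{\chi \in \widehat{\mathbb{F}_q^{*}}} \prod_{i=1}^{m} \frac{g(A_i \chi)}{g(A_i)} \frac{g(\overline{B_i \chi})}{g(\overline{B_i})}\, \chi(-1)^{m} \chi(\lambda).$$ *)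

(* Defs.v *)
From HB Require Import structures.
From mathcomp Require Import all_boot all_order all_algebra all_fingroup.
From mathcomp Require Import all_solvable all_field all_character.

Set Implicit Arguments.
Unset Strict Implicit.
Unset Printing Implicit Defensive.

Import Order.TTheory GRing.Theory Num.Theory.
Local Open Scope ring_scope.

(* A multiplicative character of F is a linear character of the unit group,
   seen as an element of the commutative ring of class functions, where 1 is
   the trivial character, * the pointwise product and, for linear characters,
   ^-1 the inverse character.  Complex values are taken in algC, as in the
   library's character theory; nothing is lost, since linear characters of a
   finite group only take roots of unity as values. *)
Notation mult_classfun F := (classfun [set: {unit F}]%G).

(* Since {unit F} is abelian, its linear characters are exactly its
   irreducible ones, so that they are enumerated by the finite type
   Iirr [set: {unit F}]. *)
Notation mult_Iirr F := (Iirr [set: {unit F}]%G).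

Lemma mult_charP (F : finFieldType) (chi : mult_classfun F) :
  reflect (exists i : mult_Iirr F, chi = 'chi_i) (chi \is a linear_char).
Proof.
have abU : abelian [set: {unit F}].
  by apply/centsP=> x _ y _; apply: val_inj; rewrite /= mulrC.
apply: (iffP idP) => [/lin_char_irr/irrP // | [i ->]].
by move/char_abelianP: abU; apply.
Qed.

(* Extension by 0 at 0, for every character, the trivial one included. *)
Definition mult_ext (F : finFieldType) (chi : mult_classfun F) (x : F) : algC :=
  if insub x is Some u then chi (u : {unit F}) else 0.

Definition additive_char (F : finFieldType) (theta : F -> algC) : Prop :=
  theta 0 = 1 /\ {morph theta : x y / x + y >-> x * y}.

Definition nontrivial_additive_char (F : finFieldType) (theta : F -> algC) :
    Prop :=
  additive_char theta /\ exists x : F, theta x != 1.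

Definition gauss (F : finFieldType) (theta : F -> algC)
    (chi : mult_classfun F) : algC :=
  \sum_(x : F) mult_ext chi x * theta x.

Definition hypergeometric (F : finFieldType) (theta : F -> algC) (m : nat)
    (A B : m.-tuple (mult_classfun F)) (lambda : F) : algC :=
  let g := gauss theta in
  - 1 / (#|F|%:R - 1) *
  \sum_(i : mult_Iirr F)
    (\prod_(j < m) (g (tnth A j * 'chi_i) / g (tnth A j)
                    * (g (tnth B j * 'chi_i)^-1 / g (tnth B j)^-1)))
    * mult_ext 'chi_i (- 1) ^+ m * mult_ext 'chi_i lambda.

(* Main.v *)
(* Put B = A^2 and let phi be the quadratic character.  The twelve Gauss sums
   pair off under the Hasse-Davenport relation, which turns the summand into a
   product of three Jacobi sums evaluated at chi^2; summing over chi replaces the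
   6F6 by (T(1) + T(-1)) / q, where
     T(e) = sum_{a,b} (phi B)(ab) phi(b + e a) phi((1+a)(1+b)).
   For e = -1, phi(b - a) is R of the discriminant of (X+a)(X+b) when R^2 = phi,
   and T(-1) is the sum over R of a two-variable Selberg sum, evaluated by
   Anderson's method; this gives the sum over R.
   For e = 1, grouping the pairs (a, b) by their sum s and product p gives a sum
   over a conic, equal to q, plus the B-weighted sum over p of character sums on
   the elliptic curves y^2 = s (1 + s + p) (s^2 - 4p).  A 2-isogeny and the
   substitution z = y + 1/y rewrite the latter as
     sum_{w,t} B(w) chi4(t) phi(w + 1/w + t + 1/t),
   which vanishes by (w, t) -> (-w, -t) if chi4(-1) = -1, that is if q is not
   1 mod 8, and otherwise factors into Jacobi sums in the coordinates w/t and wt;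
   this gives the sum over S. *)
Require Import Defs.
From HB Require Import structures.
From mathcomp Require Import all_boot all_order all_algebra all_fingroup.
From mathcomp Require Import all_solvable all_field all_character.
From mathcomp Require Import ring.

Set Implicit Arguments.
Unset Strict Implicit.
Unset Printing Implicit Defensive.

Import Order.TTheory GRing.Theory Num.Theory.
Local Open Scope ring_scope.

(** * Multiplicative characters extended by zero, and their orthogonality *)

Section Extension.

Variable F : finFieldType.
Implicit Types (X Y : mult_classfun F) (x y : F).

Lemma mult_ext_unit X (u : {unit F}) : mult_ext X (val u) = X u.
Proof. by rewrite /mult_ext valK. Qed.

Lemma mult_ext0 X : mult_ext X 0 = 0.
Proof. by rewrite /mult_ext insubF // unitfE eqxx. Qed.

Lemma unit_fieldP x : x != 0 -> exists u : {unit F}, x = val u.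
Proof. by rewrite -unitfE => Ux; exists (FinRing.unit F Ux). Qed.

Lemma mult_extMl X Y x : mult_ext (X * Y) x = mult_ext X x * mult_ext Y x.
Proof.
have [->|/unit_fieldP[u ->]] := eqVneq x 0; first by rewrite !mult_ext0 mul0r.
by rewrite !mult_ext_unit cfunE.
Qed.

Lemma mult_ext_triv x : mult_ext 1 x = (x != 0)%:R.
Proof.
have [->|/[dup] nzx /unit_fieldP[u xE]] := eqVneq x 0; first by rewrite mult_ext0.
by rewrite xE mult_ext_unit cfun1E inE.
Qed.

Lemma mult_ext_eq X Y :
  (forall x, x != 0 -> mult_ext X x = mult_ext Y x) -> X = Y.
Proof.
move=> XY; apply/cfunP=> u; rewrite -!mult_ext_unit XY //.
by rewrite -unitfE (valP u).
Qed.

Lemma mult_ext1 X : X \is a linear_char -> mult_ext X 1 = 1.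
Proof. by move=> linX; rewrite -FinRing.val_unit1 mult_ext_unit lin_char1. Qed.

Lemma mult_extM X x y : X \is a linear_char ->
  mult_ext X (x * y) = mult_ext X x * mult_ext X y.
Proof.
move=> linX.
have [->|/unit_fieldP[u ->]] := eqVneq x 0; first by rewrite mul0r mult_ext0 mul0r.
have [->|/unit_fieldP[v ->]] := eqVneq y 0; first by rewrite mulr0 mult_ext0 mulr0.
by rewrite -FinRing.val_unitM !mult_ext_unit lin_charM ?inE.
Qed.

Lemma mult_extX X x n : X \is a linear_char ->
  mult_ext X (x ^+ n) = mult_ext X x ^+ n.
Proof.
move=> linX; elim: n => [|n IHn]; first by rewrite !expr0 mult_ext1.
by rewrite !exprS mult_extM // IHn.
Qed.

Lemma mult_ext_neq0 X x : X \is a linear_char -> x != 0 -> mult_ext X x != 0.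
Proof.
by move=> linX /unit_fieldP[u ->]; rewrite mult_ext_unit lin_char_neq0 ?inE.
Qed.

Lemma mult_extV X x : X \is a linear_char ->
  mult_ext X x^-1 = (mult_ext X x)^-1.
Proof.
move=> linX; have [->|nzx] := eqVneq x 0; first by rewrite invr0 !mult_ext0 invr0.
apply: (mulfI (mult_ext_neq0 linX nzx)).
by rewrite -mult_extM // divff // mult_ext1 // divff // mult_ext_neq0.
Qed.

Lemma mult_extVl X x : X \is a linear_char ->
  mult_ext X^-1 x = (mult_ext X x)^-1.
Proof.
move=> linX; have [->|nzx] := eqVneq x 0; first by rewrite !mult_ext0 invr0.
apply: (mulfI (mult_ext_neq0 linX nzx)).
rewrite -mult_extMl divrr ?lin_char_unitr // mult_ext_triv nzx.
by rewrite divff // mult_ext_neq0.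
Qed.

Lemma mult_extXl X x n : x != 0 -> mult_ext (X ^+ n) x = mult_ext X x ^+ n.
Proof.
move=> nzx; elim: n => [|n IHn]; first by rewrite !expr0 mult_ext_triv nzx.
by rewrite !exprS mult_extMl IHn.
Qed.

Lemma natr_card_predF : #|F|.-1%:R = #|F|%:R - 1 :> algC.
Proof. by rewrite -subn1 natrB // (cardD1 (0 : F)). Qed.

Lemma sum_mult_ext_triv : \sum_x mult_ext (1 : mult_classfun F) x = #|F|%:R - 1.
Proof.
rewrite (bigD1 0) //= mult_ext0 add0r (eq_bigr (fun=> 1)) => [|x nzx].
  by rewrite sumr_const cardC1 natr_card_predF.
by rewrite mult_ext_triv nzx.
Qed.

Lemma sum_mult_ext X : X \is a linear_char -> X != 1 -> \sum_x mult_ext X x = 0.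
Proof.
move=> linX ntX; have [y nzy Xy] : exists2 y, y != 0 & mult_ext X y != 1.
  apply/exists_inP; apply: contraR ntX; rewrite negb_exists_in => /forall_inP X1.
  apply/eqP/mult_ext_eq => x nzx; rewrite mult_ext_triv nzx.
  by have := X1 x nzx; rewrite negbK => /eqP.
have S : \sum_x mult_ext X x = mult_ext X y * \sum_x mult_ext X x.
  rewrite mulr_sumr (reindex_inj (mulfI nzy)) /=.
  by under eq_bigr => x _ do rewrite mult_extM //.
apply/eqP; have /eqP := S; rewrite -subr_eq0 -{1}[\sum_x _]mul1r -mulrBl.
by rewrite mulf_eq0 subr_eq0 eq_sym (negPf Xy).
Qed.

Lemma irr_mult_linear (i : mult_Iirr F) : 'chi_i \is a linear_char.
Proof. by apply/mult_charP; exists i. Qed.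

(** Column orthogonality, read off the regular character: all irreducible characters have degree
    1. *)
Lemma sum_irr_mult_ext x :
  \sum_(i : mult_Iirr F) mult_ext 'chi_i x = (#|F|%:R - 1) *+ (x == 1).
Proof.
have [->|/unit_fieldP[u ->]] := eqVneq x 0.
  by rewrite big1 => [|i _]; rewrite ?mult_ext0 // eq_sym oner_eq0.
have := congr1 (fun f : mult_classfun F => f u) (cfReg_sum [set: {unit F}]%G).
rewrite cfRegE sum_cfunE -val_eqE /= => E.
rewrite (eq_bigr (fun i => ('chi_i 1%g *: 'chi_i) u)); last first.
  by move=> i _; rewrite mult_ext_unit cfunE lin_char1 ?mul1r ?irr_mult_linear.
by rewrite -E card_finField_unit natr_card_predF.
Qed.

End Extension.

(* X(-1) J(X, Y), where J is the classical Jacobi sum. *)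
Definition jacobi (F : finFieldType) (X Y : mult_classfun F) : algC :=
  \sum_(u : F) mult_ext X u * mult_ext Y (1 + u).

(** * Gauss sums, the reflection formula and Jacobi sums *)

Section GaussSums.

Variables (F : finFieldType) (theta : F -> algC).
Hypothesis theta_char : nontrivial_additive_char theta.
Implicit Types (X Y : mult_classfun F) (x y : F).

Local Notation g := (gauss theta).
Local Notation q := (#|F|%:R : algC).

Let theta0 : theta 0 = 1. Proof. by case: theta_char => -[]. Qed.
Let thetaD : {morph theta : x y / x + y >-> x * y}.
Proof. by case: theta_char => -[]. Qed.

Lemma natr_card_neq0 : q != 0.
Proof. by rewrite pnatr_eq0 (cardD1 (0 : F)). Qed.

Lemma sum_additive_char : \sum_x theta x = 0.
Proof.
case: theta_char => _ [y theta_y].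
have S : \sum_x theta x = theta y * \sum_x theta x.
  rewrite mulr_sumr (reindex_inj (addrI y)) /=.
  by under eq_bigr => x _ do rewrite thetaD.
apply/eqP; have /eqP := S; rewrite -subr_eq0 -{1}[\sum_x _]mul1r -mulrBl.
by rewrite mulf_eq0 subr_eq0 eq_sym (negPf theta_y).
Qed.

Lemma gauss_triv : g 1 = -1.
Proof.
have := sum_additive_char; rewrite (bigD1 0) //= theta0 => /eqP.
rewrite addrC addr_eq0 => /eqP <-.
rewrite /gauss (bigD1 0) //= mult_ext0 mul0r add0r.
by apply: eq_bigr => x nzx; rewrite mult_ext_triv nzx mul1r.
Qed.

(** Rescaling [y] settles nonzero [a]; at [a = 0] both sides vanish because [X] is nontrivial. *)
Lemma gauss_dilate X a : X \is a linear_char -> X != 1 ->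
  \sum_y mult_ext X y * theta (y * a) = mult_ext X^-1 a * g X.
Proof.
move=> linX ntX; have [->|nza] := eqVneq a 0.
  under eq_bigr => y _ do rewrite mulr0 theta0 mulr1.
  by rewrite sum_mult_ext // mult_ext0 mul0r.
rewrite mult_extVl // -mult_extV // mulr_sumr [RHS](reindex_inj (mulIf nza)) /=.
by apply: eq_bigr => y _; rewrite mulrA -mult_extM // mulrCA mulVf // mulr1.
Qed.

(* Substituting x = u y in the double sum for g(X) g(Y). *)
Lemma gauss_mul_slope X Y : X \is a linear_char -> Y \is a linear_char ->
  g X * g Y
  = \sum_u mult_ext X u * \sum_y mult_ext (X * Y) y * theta (y * (1 + u)).
Proof.
move=> linX linY; rewrite mulrC big_distrl /=.
under [RHS]eq_bigr => u _ do rewrite mulr_sumr.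
rewrite exchange_big /=; apply: eq_bigr => y _.
have [->|nzy] := eqVneq y 0.
  by rewrite mult_ext0 !mul0r big1 // => u _; rewrite mult_ext0 mul0r mulr0.
rewrite [g X]/gauss mulr_sumr (reindex_inj (mulIf nzy)) /=; apply: eq_bigr => u _.
rewrite mult_extM // mult_extMl mulrDr mulr1 thetaD [y * u]mulrC.
by rewrite !mulrA; congr (_ * _); ring.
Qed.

(** In [gauss_mul_slope] with [Y = X^-1], the inner sum is [q - 1] at [u = -1] and [-1] at every
    other [u]. *)
Lemma gauss_mulV X : X \is a linear_char -> X != 1 ->
  g X * g X^-1 = mult_ext X (-1) * q.
Proof.
move=> linX ntX; rewrite gauss_mul_slope ?rpredVr // divrr ?lin_char_unitr //.
rewrite (eq_bigr (fun u => mult_ext X u * (q *+ (u == -1)) - mult_ext X u)).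
  rewrite sumrB sum_mult_ext // subr0 (bigD1 (-1)) //= eqxx mulr1n.
  by rewrite big1 ?addr0 // => u /negPf->; rewrite mulr0n mulr0.
move=> u _; rewrite -[X in _ = _ - X]mulr1 -mulrBr; congr (_ * _).
have [->|u_n1] := eqVneq u (-1).
  under eq_bigr => y _ do rewrite addrN mulr0 theta0 mulr1.
  exact: sum_mult_ext_triv.
have nz1u : 1 + u != 0 by rewrite addrC addr_eq0.
rewrite mulr0n sub0r -gauss_triv /gauss [RHS](reindex_inj (mulIf nz1u)) /=.
by apply: eq_bigr => y _; rewrite !mult_ext_triv mulf_eq0 (negPf nz1u) orbF.
Qed.

Lemma gauss_neq0 X : X \is a linear_char -> g X != 0.
Proof.
move=> linX; have [->|ntX] := eqVneq X 1; first by rewrite gauss_triv oppr_eq0 oner_eq0.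
have : g X * g X^-1 != 0.
  rewrite gauss_mulV // mulf_neq0 ?natr_card_neq0 // mult_ext_neq0 //.
  by rewrite oppr_eq0 oner_eq0.
by rewrite mulf_eq0 negb_or => /andP[].
Qed.

(** Apply [gauss_mul_slope] to [X] and [(X * Y)^-1], whose product is [Y^-1]; [gauss_dilate] gives
    the inner sums. Unlike [jacobiE], this form covers [X * Y = 1]. *)
Lemma jacobi_gaussV X Y : X \is a linear_char -> Y \is a linear_char -> Y != 1 ->
  jacobi X Y * g Y^-1 = g X * g (X * Y)^-1.
Proof.
move=> linX linY ntY; have linXY : X * Y \is a linear_char by rewrite rpredM.
rewrite gauss_mul_slope ?rpredVr // invrM ?lin_char_unitr // [X * _]mulrC.
rewrite mulrVK ?lin_char_unitr //.
have ntVY : Y^-1 != 1 by rewrite invr_eq1.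
rewrite /jacobi mulr_suml; apply: eq_bigr => u _.
by rewrite gauss_dilate ?rpredVr // invrK mulrA.
Qed.

Lemma jacobiE X Y : X \is a linear_char -> Y \is a linear_char ->
  Y != 1 -> X * Y != 1 ->
  jacobi X Y = mult_ext X (-1) * g X * g Y / g (X * Y).
Proof.
move=> linX linY ntY ntXY; have linXY : X * Y \is a linear_char by rewrite rpredM.
have linVY : Y^-1 \is a linear_char by rewrite rpredVr.
have gY := gauss_neq0 linY; have gVY := gauss_neq0 linVY.
have gXY := gauss_neq0 linXY.
have E := jacobi_gaussV linX linY ntY.
have EY := gauss_mulV linY ntY; have EXY := gauss_mulV linXY ntXY.
have V : g (X * Y)^-1 = mult_ext X (-1) * mult_ext Y (-1) * q / g (X * Y).
  by rewrite -mult_extMl -EXY [RHS]mulrC mulKf.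
apply: (mulIf gVY); rewrite E V -mulrA mulrACA mulrA.
have -> : g Y^-1 = mult_ext Y (-1) * q / g Y by rewrite -EY [RHS]mulrC mulKf.
by field; rewrite gY gXY.
Qed.

Lemma jacobi_mulV X : X \is a linear_char -> X != 1 -> jacobi X X^-1 = -1.
Proof.
move=> linX ntX; have linV : X^-1 \is a linear_char by rewrite rpredVr.
have ntV : X^-1 != 1 by rewrite invr_eq1.
have := jacobi_gaussV linX linV ntV.
rewrite divrr ?lin_char_unitr // invr1 invrK gauss_triv mulrC => E.
by apply: (mulfI (gauss_neq0 linX)).
Qed.

End GaussSums.

(** * The quadratic character and the counting of square roots *)

Section Quadratic.

Variable F : finFieldType.
Implicit Types (X Y : mult_classfun F) (x y z : F).

Lemma mult_generator : exists u : {unit F},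
  (forall v : {unit F}, exists k, v = (u ^+ k)%g) /\ #[u]%g = #|F|.-1.
Proof.
have /cyclicP[u Eu] := field_unit_group_cyclic [set: {unit F}]%G.
exists u; split=> [v|]; last by rewrite orderE -Eu card_finField_unit.
by have /cycleP : v \in <[u]>%g by rewrite -Eu inE.
Qed.

Lemma lin_char_generator X Y (u : {unit F}) :
  X \is a linear_char -> Y \is a linear_char ->
  (forall v : {unit F}, exists k, v = (u ^+ k)%g) -> X u = Y u -> X = Y.
Proof.
move=> linX linY gen_u XYu; apply/cfunP=> v; have [k ->] := gen_u v.
by rewrite !lin_charX ?inE // XYu.
Qed.

Lemma sqr_eq1 X : X \is a linear_char -> X ^+ 2 = 1 -> forall u : {unit F},
  X u = 1 \/ X u = -1.
Proof.
move=> linX X2 u; have := congr1 (fun Y : mult_classfun F => Y u) X2.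
rewrite expS_cfunE cfun1E inE => /eqP; rewrite sqrf_eq1.
by case/orP=> /eqP; [left | right].
Qed.

Variable phi : mult_classfun F.
Hypotheses (lin_phi : phi \is a linear_char) (phi2 : phi ^+ 2 = 1).
Hypothesis nt_phi : phi != 1.

Lemma quadratic_generator (u : {unit F}) :
  (forall v : {unit F}, exists k, v = (u ^+ k)%g) -> phi u = -1.
Proof.
move=> gen_u; have [phi_u|//] := sqr_eq1 lin_phi phi2 u.
case/eqP: nt_phi; apply: (lin_char_generator lin_phi (rpred1 _) gen_u).
by rewrite phi_u cfun1E inE.
Qed.

Lemma lin_char_sqr_eq1 X : X \is a linear_char -> X ^+ 2 = 1 -> X = 1 \/ X = phi.
Proof.
move=> linX X2; have [u [gen_u _]] := mult_generator.
have [Xu|Xu] := sqr_eq1 linX X2 u; [left | right].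
  by apply: (lin_char_generator linX (rpred1 _) gen_u); rewrite Xu cfun1E inE.
by apply: (lin_char_generator linX lin_phi gen_u); rewrite Xu quadratic_generator.
Qed.

(** Two characters with equal squares differ by a character of square 1, which is [1] or [phi]. *)
Lemma sum_irr_sqr_eq (V : mult_classfun F) (H : mult_classfun F -> algC) :
  V \is a linear_char ->
  \sum_(i : mult_Iirr F | 'chi_i ^+ 2 == V ^+ 2) H 'chi_i = H V + H (phi * V).
Proof.
move=> linV; have linPV : phi * V \is a linear_char by rewrite rpredM.
have UV := lin_char_unitr linV.
have /mult_charP[i Vi] := linV; have /mult_charP[j PVj] := linPV.
have nij : j != i.
  apply: contra nt_phi => /eqP eij; apply/eqP/(mulIr UV).
  by rewrite PVj eij -Vi mul1r.
rewrite (bigD1 i) /=; last by rewrite -Vi.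
rewrite (bigD1 j) /=; last by rewrite -PVj exprMn phi2 mul1r eqxx.
rewrite -Vi -PVj big1 ?addr0 // => k /andP[/andP[/eqP k2 ki] kj].
have linR : 'chi_k / V \is a linear_char by rewrite rpred_div ?irr_mult_linear.
have R2 : ('chi_k / V) ^+ 2 = 1 by rewrite exprMn exprVn k2 divrr // unitrX.
have [R1|R1] := lin_char_sqr_eq1 linR R2.
  have : 'chi_k = 'chi_i by rewrite -Vi -[LHS](divrK UV) R1 mul1r.
  by move/irr_inj/eqP; rewrite (negPf ki).
have : 'chi_k = 'chi_j by rewrite -PVj -[LHS](divrK UV) R1.
by move/irr_inj/eqP; rewrite (negPf kj).
Qed.

Lemma quadraticX x : x != 0 -> mult_ext phi x ^+ 2 = 1.
Proof. by move=> nzx; rewrite -mult_extXl // phi2 mult_ext_triv nzx. Qed.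

Lemma quadratic_sqr x : x != 0 -> mult_ext phi (x ^+ 2) = 1.
Proof. by move=> nzx; rewrite mult_extX // quadraticX. Qed.

Lemma quadratic_mulKx x y : x != 0 -> mult_ext phi (x ^+ 2 * y) = mult_ext phi y.
Proof. by move=> nzx; rewrite mult_extM // quadratic_sqr // mul1r. Qed.

Lemma quadraticV x : mult_ext phi x^-1 = mult_ext phi x.
Proof.
have [->|nzx] := eqVneq x 0; first by rewrite invr0.
by rewrite -[RHS](quadratic_mulKx _ (invr_neq0 nzx)) expr2 mulfVK.
Qed.

Lemma quadraticVl : phi^-1 = phi.
Proof. by apply: (mulrI (lin_char_unitr lin_phi)); rewrite divrr ?lin_char_unitr. Qed.

(** A nonsquare is an odd power of a generator, and [phi] is [-1] at a generator. *)
Lemma quadratic_nonsqr x : x != 0 -> (forall w, x != w ^+ 2) -> mult_ext phi x = -1.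
Proof.
move=> /unit_fieldP[v ->] nsq; have [u [gen_u _]] := mult_generator.
have [k vE] := gen_u v; rewrite mult_ext_unit vE lin_charX ?inE //.
rewrite (quadratic_generator gen_u) -signr_odd; case: (boolP (odd k)) => // ev_k.
have := nsq (val (u ^+ k./2)%g); rewrite -FinRing.val_unitX -expgM muln2 even_halfK //.
by rewrite vE eqxx.
Qed.

(** In characteristic two, squaring is injective, hence onto, so [phi] would be 1 at every nonzero
    element. *)
Lemma two_neq0 : 2 != 0 :> F.
Proof.
apply/eqP=> two0; have sq_inj : injective (fun x => x ^+ 2).
  move=> x y /eqP; rewrite -subr_eq0.
  have -> : x ^+ 2 - y ^+ 2 = (x - y) ^+ 2 + 2 * (y * (x - y)) by ring.
  by rewrite two0 mul0r addr0 sqrf_eq0 subr_eq0 => /eqP.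
case/eqP: nt_phi; apply/mult_ext_eq => x nzx; rewrite mult_ext_triv nzx.
have [sqV _ sqK] := injF_bij sq_inj; rewrite -[x]sqK quadratic_sqr //.
by apply: contraNneq nzx => Vx0; rewrite -[x]sqK Vx0 expr0n.
Qed.

(** [1 + phi y] is the number of square roots of [y], including at [y = 0], where [phi] is 0. *)
Lemma sum_sqr (G : F -> algC) :
  \sum_z G (z ^+ 2) = \sum_y (1 + mult_ext phi y) * G y.
Proof.
rewrite (partition_big (fun z => z ^+ 2) predT) //=; apply: eq_bigr => y _.
rewrite (eq_bigr (fun=> G y)) => [|z /eqP-> //].
have [->|nzy] := eqVneq y 0.
  rewrite mult_ext0 addr0 mul1r (bigD1 0) ?expr0n //= big1 ?addr0 // => z.
  by rewrite sqrf_eq0 => /andP[->].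
have [/existsP[w /eqP yE]|] := boolP [exists w, y == w ^+ 2]; last first.
  rewrite negb_exists => /forallP nsq; rewrite quadratic_nonsqr // addrN mul0r.
  by rewrite big1 // => z /eqP zy; have := nsq z; rewrite zy eqxx.
have nzw : w != 0 by apply: contraNneq nzy => w0; rewrite yE w0 expr0n.
have nww : - w != w.
  by rewrite eq_sym -addr_eq0 -mulr2n -mulr_natl mulf_neq0 ?two_neq0.
rewrite yE quadratic_sqr // (bigD1 w) //= (bigD1 (- w)) /=; last first.
  by rewrite sqrrN eqxx.
rewrite big1 => [|z /andP[/andP[]]]; first by rewrite addr0; ring.
by rewrite eqf_sqr => /orP[]/eqP->; rewrite eqxx.
Qed.

(* a and s - a are the roots of X^2 - s X + p when p = a (s - a). *)
Lemma sum_pairs (G : F -> F -> algC) :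
  \sum_a \sum_b G (a + b) (a * b)
  = \sum_s \sum_p (1 + mult_ext phi (s ^+ 2 - 4 * p)) * G s p.
Proof.
have nz2 := two_neq0.
have -> : \sum_a \sum_b G (a + b) (a * b) = \sum_s \sum_a G s (a * (s - a)).
  rewrite [RHS]exchange_big /=; apply: eq_bigr => a _.
  rewrite [RHS](reindex_inj (addrI a)) /=; apply: eq_bigr => b _.
  by rewrite [a + b - a]addrC addKr.
apply: eq_bigr => s _.
(* With [a = (s + z) / 2], [z ^+ 2] is the discriminant [s ^+ 2 - 4 * p], and [h] recovers [p] from
   it. *)
pose f z := (s + z) / 2; pose h y := (s ^+ 2 - y) / 4.
have nz4 : 4 != 0 :> F by rewrite (_ : 4 = 2 * 2) ?mulf_neq0 // -natrM.
have f_inj : injective f by move=> x y /(divIf nz2)/addrI.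
have h_inj : injective (fun p => s ^+ 2 - 4 * p).
  by move=> x y /addrI/oppr_inj/(mulfI nz4).
rewrite (reindex_inj f_inj) /=.
rewrite (eq_bigr (fun z => G s (h (z ^+ 2)))); last first.
  move=> z _; congr (G s _); rewrite /f /h; field.
  by rewrite nz2 nz4.
rewrite (sum_sqr (fun y => G s (h y))) (reindex_inj h_inj) /=.
apply: eq_bigr => p _; congr (_ * G s _); rewrite /h; field.
exact: nz4.
Qed.

End Quadratic.

(** * The duplication case of the Hasse-Davenport relation *)

Section HasseDavenport.

Variables (F : finFieldType) (theta : F -> algC).
Hypothesis theta_char : nontrivial_additive_char theta.
Variable phi : mult_classfun F.
Hypotheses (lin_phi : phi \is a linear_char) (phi2 : phi ^+ 2 = 1).
Hypothesis nt_phi : phi != 1.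
Implicit Types (X Y : mult_classfun F) (s p : F).

Local Notation g := (gauss theta).
Local Notation q := (#|F|%:R : algC).

Lemma four_neq0 : 4 != 0 :> F.
Proof.
have nz2 := two_neq0 lin_phi phi2 nt_phi.
by rewrite (_ : 4 = 2 * 2) ?mulf_neq0 // -natrM.
Qed.

Lemma gauss_quadratic_sqr : g phi ^+ 2 = mult_ext phi (-1) * q.
Proof.
by rewrite -(gauss_mulV theta_char lin_phi nt_phi) (quadraticVl lin_phi phi2) expr2.
Qed.

(** Completing the square leaves [z ^+ 2 - D], and [sum_sqr] turns the sum into a Jacobi sum. The
    last hypothesis excludes a perfect square at [X = phi], where every term off the double root is
    1. *)
Lemma sum_mult_ext_quadratic X s p : X \is a linear_char -> X != 1 ->
  s ^+ 2 - 4 * p != 0 \/ phi * X != 1 ->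
  \sum_a mult_ext X (a ^+ 2 + s * a + p)
  = (mult_ext X 4)^-1 * mult_ext (phi * X) (- (s ^+ 2 - 4 * p)) * jacobi phi X.
Proof.
move=> linX ntX; set D := s ^+ 2 - 4 * p => nondeg.
have nz2 := two_neq0 lin_phi phi2 nt_phi; have nz4 := four_neq0.
have f_inj : injective (fun z => (z - s) / 2) by move=> x y /(divIf nz2)/addIr.
rewrite (reindex_inj f_inj) /=.
rewrite (eq_bigr (fun z => (mult_ext X 4)^-1 * mult_ext X (z ^+ 2 - D))); last first.
  move=> z _; rewrite -mult_extV // -mult_extM //; congr mult_ext.
  by rewrite /D; field; rewrite nz2 nz4.
rewrite -mulr_sumr -mulrA; congr (_ * _).
rewrite (sum_sqr lin_phi phi2 nt_phi (fun y => mult_ext X (y - D))).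
under eq_bigr => y _ do rewrite mulrDl mul1r.
rewrite big_split /= (_ : \sum_y mult_ext X (y - D) = 0) ?add0r; last first.
  by rewrite -[RHS](sum_mult_ext linX ntX) [RHS](reindex_inj (addIr (- D))).
have [D0|nzD] := eqVneq D 0.
  rewrite D0 oppr0 mult_ext0 mul0r; under eq_bigr => y _ do rewrite addr0 -mult_extMl.
  by rewrite sum_mult_ext ?rpredM //; case: nondeg => //; rewrite D0 eqxx.
have nzND : - D != 0 by rewrite oppr_eq0.
rewrite (reindex_inj (mulfI nzND)) /jacobi mulr_sumr; apply: eq_bigr => u _ /=.
rewrite (_ : - D * u - D = - D * (1 + u)); last by ring.
by rewrite !mult_extM // mult_extMl; ring.
Qed.

(** [jacobi X X] is the sum of [X] over the quadratic [u ^+ 2 + u] of discriminant 1, hence a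
    multiple of [jacobi phi X]; writing both in Gauss sums gives the relation. The cases [X = 1] and
    [X = phi] are direct. *)
Lemma hasse_davenport X : X \is a linear_char ->
  g X * g (phi * X) = (mult_ext X 4)^-1 * g phi * g (X ^+ 2).
Proof.
move=> linX; have nz4 := four_neq0; have nz2 := two_neq0 lin_phi phi2 nt_phi.
have [->|ntX] := eqVneq X 1.
  by rewrite mult_ext_triv nz4 invr1 mulr1 expr1n mul1r mulrC.
have [X21|ntX2] := eqVneq (X ^+ 2) 1.
  have [/eqP|->] := lin_char_sqr_eq1 lin_phi phi2 nt_phi linX X21.
    by rewrite (negPf ntX).
  by rewrite -expr2 phi2 (natrX _ 2 2) quadratic_sqr // invr1 mul1r.
have ntPX : phi * X != 1.
  apply: contraNneq ntX2 => PX1.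
  have <- : (phi * X) ^+ 2 = X ^+ 2 by rewrite exprMn phi2 mul1r.
  by rewrite PX1 expr1n.
have linPX : phi * X \is a linear_char by rewrite rpredM.
have linX2 : X ^+ 2 \is a linear_char by rewrite rpredX.
have JXX : jacobi X X = (mult_ext X 4)^-1 * mult_ext (phi * X) (-1) * jacobi phi X.
  have := sum_mult_ext_quadratic linX ntX (or_intror ntPX) (s := 1) (p := 0).
  rewrite expr1n mulr0 subr0 => <-; apply: eq_bigr => u _.
  by rewrite -mult_extM //; congr mult_ext; ring.
have N1 : mult_ext phi (-1) ^+ 2 = 1 by rewrite quadraticX // oppr_eq0 oner_eq0.
move: JXX; rewrite !(jacobiE theta_char) -?expr2 // mult_extMl.
have X1 : mult_ext X (-1) != 0 by rewrite mult_ext_neq0 // oppr_eq0 oner_eq0.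
have X4 : mult_ext X 4 != 0 by rewrite mult_ext_neq0.
have gX := gauss_neq0 theta_char linX; have gPX := gauss_neq0 theta_char linPX.
have gX2 := gauss_neq0 theta_char linX2.
move=> E; apply: (mulfI (mulf_neq0 X1 gX)); rewrite mulrA.
move/(congr1 (fun z => z * g (X ^+ 2) * g (phi * X))): E.
rewrite divfK // => ->.
transitivity ((mult_ext X 4)^-1 * (mult_ext phi (-1) ^+ 2) * mult_ext X (-1)
   * g phi * g X * g (X ^+ 2)); first by field; rewrite X4 gPX.
by rewrite N1; ring.
Qed.

Lemma jacobi_quadratic X : X \is a linear_char ->
  jacobi (phi * X) phi = g (phi * X) * g X^-1 / g phi.
Proof.
move=> linX; have linPX : phi * X \is a linear_char by rewrite rpredM.
have gp := gauss_neq0 theta_char lin_phi.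
apply: (mulIf gp); rewrite divfK //.
have := jacobi_gaussV theta_char linPX lin_phi nt_phi.
by rewrite mulrAC -expr2 phi2 mul1r (quadraticVl lin_phi phi2).
Qed.

(** Since [chi4^-1 = phi * chi4], the four factors form two Hasse-Davenport pairs, and the values of
    [X] at 4 cancel. Blocks of this shape make up the summand of the 6F6. *)
Lemma gauss_quartic X (chi4 : mult_classfun F) :
  X \is a linear_char -> chi4 \is a linear_char -> chi4 ^+ 2 = phi ->
  g (chi4 * X) * g (chi4^-1 * X) * (g X^-1 * g (phi * X^-1))
  = (mult_ext chi4 4)^-1 * g phi ^+ 3 * jacobi (phi * X ^+ 2) phi.
Proof.
move=> linX lin4 chi42; have U4 := lin_char_unitr lin4.
have chi4V : chi4^-1 = phi * chi4.
  by apply: (mulIr U4); rewrite mulVr // -mulrA -expr2 chi42 -expr2 phi2.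
have lin4X : chi4 * X \is a linear_char by rewrite rpredM.
have linV : X^-1 \is a linear_char by rewrite rpredVr.
have linX2 : X ^+ 2 \is a linear_char by rewrite rpredX.
have gp := gauss_neq0 theta_char lin_phi.
have X4 : mult_ext X 4 != 0 by rewrite mult_ext_neq0 // four_neq0.
have C4 : mult_ext chi4 4 != 0 by rewrite mult_ext_neq0 // four_neq0.
rewrite jacobi_quadratic // chi4V -[phi * chi4 * X]mulrA !hasse_davenport //.
by rewrite exprMn chi42 mult_extMl mult_extVl // exprVn; field; rewrite X4 C4 gp.
Qed.

End HasseDavenport.

(** * Selberg-type sums over monic quadratics *)

Section SelbergSums.

Variable F : finFieldType.
Implicit Types (X Y A B C R : mult_classfun F) (a b s p x y : F).

Lemma sum_jacobi_dilate X Y b : X \is a linear_char -> Y \is a linear_char ->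
  X * Y != 1 ->
  \sum_y mult_ext X y * mult_ext Y (b + y) = mult_ext (X * Y) b * jacobi X Y.
Proof.
move=> linX linY ntXY; have [->|nzb] := eqVneq b 0.
  rewrite mult_ext0 mul0r; under eq_bigr => y _ do rewrite add0r -mult_extMl.
  by rewrite sum_mult_ext ?rpredM.
rewrite (reindex_inj (mulfI nzb)) /jacobi mulr_sumr; apply: eq_bigr => u _ /=.
rewrite -[X in X + b * u]mulr1 -mulrDr !mult_extM // mult_extMl; ring.
Qed.

(* The values of a monic quadratic P at 0, 1 and a are only subject to
   P(0)/a + P(1)/(1-a) - P(a)/(a(1-a)) = 1, so for fixed a the sum is a
   Jacobi sum in three characters. *)
Lemma sum_quadratic_resultant A B C :
  A \is a linear_char -> B \is a linear_char -> C \is a linear_char ->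
  A != 1 -> B != 1 -> B * C != 1 ->
  \sum_a \sum_s \sum_p mult_ext A p * mult_ext B (1 + s + p)
     * mult_ext C (a ^+ 2 + s * a + p)
  = mult_ext (A * C) (-1) * jacobi (A * C) (B * C)
    * (mult_ext (A * (B * C)) (-1) * jacobi A (B * C) * jacobi B C).
Proof.
move=> linA linB linC ntA ntB ntBC.
have linBC : B * C \is a linear_char by rewrite rpredM.
have linAC : A * C \is a linear_char by rewrite rpredM.
(* [M] is the inner sum for generic [a] in the coordinates [x = P(0) / a] and [y = P(1) / (1 - a)],
   stripped of its characters of [a] and [1 - a]. *)
pose M := \sum_x \sum_y mult_ext A x * mult_ext B y * mult_ext C (x - 1 + y).
have -> : mult_ext (A * (B * C)) (-1) * jacobi A (B * C) * jacobi B C = M.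
  rewrite /M; under eq_bigr => x _ do
    [under eq_bigr do rewrite -mulrA; rewrite -mulr_sumr sum_jacobi_dilate // mulrA].
  rewrite -mulr_suml; congr (_ * _).
  rewrite (reindex_inj oppr_inj) /jacobi mulr_sumr; apply: eq_bigr => x _ /=.
  rewrite -[- x]mulN1r (_ : -1 * x - 1 = -1 * (1 + x)); last by ring.
  by rewrite !mult_extM // [mult_ext (A * _) _]mult_extMl; ring.
have -> : mult_ext (A * C) (-1) * jacobi (A * C) (B * C)
   = \sum_a mult_ext (A * C) a * mult_ext (B * C) (1 - a).
  rewrite [RHS](reindex_inj oppr_inj) /jacobi mulr_sumr; apply: eq_bigr => a _ /=.
  by rewrite opprK -[- a]mulN1r [mult_ext _ (_ * a)]mult_extM // mulrA.
rewrite mulr_suml; apply: eq_bigr => a _; rewrite exchange_big /=.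
(* [m = P(1)] replaces [s], and the argument of [C] is [P(a)] interpolated from [P(0) = p] and
   [P(1) = m]. *)
rewrite (eq_bigr (fun p => \sum_m mult_ext A p * mult_ext B m
   * mult_ext C (a * m + (1 - a) * p - a * (1 - a)))); last first.
  move=> p _; have f_inj : injective (fun m => m - (1 + p)) by apply: addIr.
  rewrite (reindex_inj f_inj); apply: eq_bigr => m _ /=.
  by congr (_ * mult_ext B _ * mult_ext C _); ring.
(* At [a = 0] and [a = 1] the relation degenerates; both sides are 0, because [B], respectively [A],
   is nontrivial. *)
have [->|nza] := eqVneq a 0.
  rewrite [RHS](_ : _ = 0); last by rewrite mult_ext0 !mul0r.
  apply: big1 => p _.
  under eq_bigr => m _ do rewrite mul0r add0r mul0r subr0 -mulrA mulrCA.
  by rewrite -mulr_suml sum_mult_ext // mul0r.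
have [->|nza1] := eqVneq a 1.
  rewrite [RHS](_ : _ = 0); last by rewrite subrr mult_ext0 mulr0 mul0r.
  rewrite exchange_big; apply: big1 => m _ /=.
  under eq_bigr => p _ do rewrite subrr mul0r addr0 mulr0 subr0 mul1r -mulrA.
  by rewrite -mulr_suml sum_mult_ext // mul0r.
have nz1a : 1 - a != 0 by rewrite subr_eq0 eq_sym.
rewrite (reindex_inj (mulfI nza)) /M mulr_sumr; apply: eq_bigr => x _ /=.
rewrite (reindex_inj (mulfI nz1a)) mulr_sumr; apply: eq_bigr => y _ /=.
rewrite (_ : _ + _ - _ = a * (1 - a) * (x - 1 + y)); last by ring.
by rewrite !mult_extM // !mult_extMl; ring.
Qed.

Variable theta : F -> algC.
Hypothesis theta_char : nontrivial_additive_char theta.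
Variable phi : mult_classfun F.
Hypotheses (lin_phi : phi \is a linear_char) (phi2 : phi ^+ 2 = 1).
Hypothesis nt_phi : phi != 1.
Hypothesis phiN1 : mult_ext phi (-1) = 1.

Local Notation g := (gauss theta).
Local Notation q := (#|F|%:R : algC).

Lemma quadraticN x : mult_ext phi (- x) = mult_ext phi x.
Proof. by rewrite -mulN1r mult_extM // phiN1 mul1r. Qed.

Lemma neg1_sqr : exists i : F, i ^+ 2 = -1.
Proof.
have [/existsP[i /eqP]|] := boolP [exists i : F, -1 == i ^+ 2]; first by exists i.
rewrite negb_exists => /forallP nsq.
have nzN1 : -1 != 0 :> F by rewrite oppr_eq0 oner_eq0.
have := quadratic_nonsqr lin_phi phi2 nt_phi nzN1 nsq.
by rewrite phiN1 => /eqP; rewrite -addr_eq0 -mulr2n pnatr_eq0.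
Qed.

(* If i^2 = -1 then -4 = (1 + i)^4. *)
Lemma quartic_N4 R : R \is a linear_char -> R ^+ 2 = phi -> mult_ext R (- 4) = 1.
Proof.
move=> linR R2; have [i i2] := neg1_sqr.
have nz4 := four_neq0 lin_phi phi2 nt_phi.
have E : - 4 = (1 + i) ^+ 4 :> F.
  transitivity (4 * i ^+ 2); first by rewrite i2 mulrN1.
  transitivity ((1 + i ^+ 2) * (i ^+ 2 + 4 * i + 5) + 4 * i ^+ 2 + (1 + i) ^+ 4
     - (1 + i) ^+ 4); first by rewrite i2; ring.
  suff -> : (1 + i) ^+ 4 = (1 + i ^+ 2) * (i ^+ 2 + 4 * i + 5) - 4.
    by rewrite i2; ring.
  by ring.
have nzi : 1 + i != 0.
  by apply: contraNneq nz4 => i0; rewrite -oppr_eq0 E i0 expr0n.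
rewrite E mult_extX // -mult_extXl // (exprM R 2 2).
by rewrite R2 phi2 mult_ext_triv nzi.
Qed.

(* The sum of (phi B)(P(0)) phi(P(1)) R(disc P) over P = X^2 + s X + p. *)
Definition selberg B R :=
  \sum_s \sum_p mult_ext (phi * B) p * mult_ext phi (1 + s + p)
     * mult_ext R (s ^+ 2 - 4 * p).

Lemma selbergE B R : B \is a linear_char -> R \is a linear_char ->
  R ^+ 2 = phi -> phi * B != 1 ->
  selberg B R = jacobi (B * R) R * jacobi (phi * B) R.
Proof.
move=> linB linR R2 ntB; pose C := phi * R.
have linC : C \is a linear_char by rewrite rpredM.
have linPB : phi * B \is a linear_char by rewrite rpredM.
have PC : phi * C = R by rewrite mulrA -expr2 phi2 mul1r.
have PBC : phi * B * C = B * R.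
  by rewrite mulrAC PC mulrC.
have ntR : R != 1 by apply: contraNneq nt_phi => R1; rewrite -R2 R1 expr1n.
have ntC : C != 1.
  apply: contraNneq nt_phi => C1; have Rphi : R = phi by rewrite -PC C1 mulr1.
  by rewrite -R2 Rphi phi2.
have ntPC : phi * C != 1 by rewrite PC.
have := sum_quadratic_resultant linPB lin_phi linC ntB nt_phi.
rewrite PC PBC => /(_ ntR).
rewrite exchange_big /=; under eq_bigr => s _ do rewrite exchange_big /=.
under eq_bigr => s _ do under eq_bigr => p _ do
  rewrite -mulr_sumr
    (sum_mult_ext_quadratic lin_phi phi2 nt_phi linC ntC (or_intror ntPC)) PC.
have -> : \sum_s \sum_p mult_ext (phi * B) p * mult_ext phi (1 + s + p)
    * ((mult_ext C 4)^-1 * mult_ext R (- (s ^+ 2 - 4 * p)) * jacobi phi C)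
  = (mult_ext C 4)^-1 * mult_ext R (-1) * jacobi phi C * selberg B R.
  rewrite mulr_sumr; apply: eq_bigr => s _; rewrite mulr_sumr.
  apply: eq_bigr => p _; rewrite -[- (_ - _)]mulN1r [mult_ext R (_ * _)]mult_extM //.
  by ring.
have J0 : jacobi phi C != 0.
  rewrite (jacobiE theta_char) ?PC // !mulf_neq0 ?invr_eq0 ?(gauss_neq0 theta_char) //.
  by rewrite phiN1 oner_eq0.
(* Because [R] is 1 at [-4], the constants [C 4] and [R (-1)] left by completing the square
   cancel. *)
have R4 : mult_ext R 4 = mult_ext R (-1).
  have RN1 : mult_ext R (-1) * mult_ext R (-1) = 1.
    by rewrite -mult_extMl -expr2 R2 phiN1.
  have := quartic_N4 linR R2; rewrite -mulN1r mult_extM // => E.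
  by rewrite -[LHS]mul1r -RN1 -mulrA E mulr1.
have C4 : mult_ext C 4 = mult_ext R (-1).
  by rewrite mult_extMl (natrX _ 2 2) quadratic_sqr ?(two_neq0 lin_phi) // mul1r -natrX.
have RN : mult_ext R (-1) != 0 by rewrite mult_ext_neq0 // oppr_eq0 oner_eq0.
have RN1 : mult_ext R (-1) ^+ 2 = 1.
  by rewrite expr2 -mult_extMl -expr2 R2 phiN1.
have BN : mult_ext B (-1) ^+ 2 = 1.
  by rewrite -mult_extX // sqrrN expr1n mult_ext1.
rewrite C4 mulVf // mul1r => E; apply: (mulfI J0); rewrite {}E.
rewrite !mult_extMl phiN1.
transitivity ((mult_ext R (-1)) ^+ 2 * mult_ext B (-1) ^+ 2 * jacobi phi C
   * (jacobi (B * R) R * jacobi (phi * B) R)); first by ring.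
by rewrite RN1 BN !mul1r.
Qed.

(** [g (phi * B)] cancels between the two Jacobi sums; the reflection formula at [R] and at
    [phi * B * R] produces the factor [q]. *)
Lemma selberg_gauss B R : B \is a linear_char -> R \is a linear_char ->
  R ^+ 2 = phi -> phi * B != 1 -> phi * B * R != 1 -> mult_ext B (-1) = 1 ->
  selberg B R = q * (g (R^-1 * phi * B) * g (R^-1 * phi * B^-1) / g R^-1 ^+ 2).
Proof.
move=> linB linR R2 ntB ntBR BN1; rewrite selbergE //.
have UR := lin_char_unitr linR; have UB := lin_char_unitr linB.
have linPB : phi * B \is a linear_char by rewrite rpredM.
have linPBR : phi * B * R \is a linear_char by rewrite rpredM.
have linBR : B * R \is a linear_char by rewrite rpredM.
have linVR : R^-1 \is a linear_char by rewrite rpredVr.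
have ntR : R != 1 by apply: contraNneq nt_phi => R1; rewrite -R2 R1 expr1n.
have RP : R^-1 * phi = R by rewrite -R2 mulKr.
have BRR : B * R * R = phi * B by rewrite -mulrA -expr2 R2 mulrC.
have VPBR : (phi * B * R)^-1 = R * B^-1.
  rewrite !invrM ?unitrM ?UR ?UB ?(lin_char_unitr lin_phi) //.
  by rewrite (quadraticVl lin_phi phi2) [B^-1 * _]mulrC mulrA RP.
rewrite !RP [R * B]mulrC !(jacobiE theta_char) ?BRR //.
have := gauss_mulV theta_char linPBR ntBR; rewrite VPBR !mult_extMl phiN1 BN1 !mul1r.
have := gauss_mulV theta_char linR ntR.
have RN1 : mult_ext R (-1) * mult_ext R (-1) = 1.
  by rewrite -mult_extMl -expr2 R2 phiN1.
have gVR := gauss_neq0 theta_char linVR.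
have gPBR := gauss_neq0 theta_char linPBR; have gPB := gauss_neq0 theta_char linPB.
move=> E1 E2.
have -> : g (R * B^-1) = mult_ext R (-1) * q / g (phi * B * R).
  by rewrite -E2 [RHS]mulrC mulKf.
have -> : g R = mult_ext R (-1) * q / g R^-1 by rewrite -E1 mulfK.
transitivity (mult_ext R (-1) * mult_ext R (-1) * (mult_ext R (-1) * q ^+ 2
   * g (B * R) / (g (phi * B * R) * g R^-1 ^+ 2))).
  by field; rewrite gVR gPBR gPB.
by rewrite RN1; field; rewrite gVR gPBR.
Qed.

End SelbergSums.

(** * The double sums [T(1)] and [T(-1)], and the elliptic fibres of the former *)

Section QuarticSums.

Variable F : finFieldType.
Implicit Types (A B S R : mult_classfun F) (a b c s p x y z w t : F).
Variables phi chi4 : mult_classfun F.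
Hypotheses (lin_phi : phi \is a linear_char) (phi2 : phi ^+ 2 = 1).
Hypotheses (nt_phi : phi != 1) (phiN1 : mult_ext phi (-1) = 1).
Hypotheses (lin_chi4 : chi4 \is a linear_char) (chi4_sqr : chi4 ^+ 2 = phi).

Variable theta : F -> algC.
Hypothesis theta_char : nontrivial_additive_char theta.

Let nz2 : 2 != 0 :> F. Proof. exact: two_neq0 lin_phi phi2 nt_phi. Qed.
Let nz4 : 4 != 0 :> F. Proof. exact: four_neq0 lin_phi phi2 nt_phi. Qed.
Let phiN x : mult_ext phi (- x) = mult_ext phi x. Proof. exact: quadraticN. Qed.
Let sum_phi : \sum_x mult_ext phi x = 0. Proof. exact: sum_mult_ext. Qed.

Definition triple_sum B (e : F) :=
  \sum_a \sum_b mult_ext (phi * B) (a * b) * mult_ext phi (b + e * a)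
     * mult_ext phi ((1 + a) * (1 + b)).

(* The Selberg sums run over all monic quadratics, the left-hand side over the
   split ones only: R + phi R vanishes at nonsquare discriminants, and
   R(d^2) = phi(d). *)
Lemma triple_sumN1 B R : R \is a linear_char -> R ^+ 2 = phi ->
  triple_sum B (-1) = selberg phi B R + selberg phi B (phi * R).
Proof.
move=> linR R2; rewrite /triple_sum /selberg -big_split /=.
pose G s p := mult_ext (phi * B) p * mult_ext phi (1 + s + p)
  * mult_ext R (s ^+ 2 - 4 * p).
have phiD x : mult_ext phi x = mult_ext R (x ^+ 2).
  have [->|nzx] := eqVneq x 0; first by rewrite expr0n !mult_ext0.
  by rewrite mult_extX // -R2 mult_extXl.
transitivity (\sum_a \sum_b G (a + b) (a * b)).
  apply: eq_bigr => a _; apply: eq_bigr => b _; rewrite /G [mult_ext phi (b + _)]phiD.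
  by rewrite mulrAC; congr (_ * mult_ext phi _ * mult_ext R _); ring.
rewrite (sum_pairs lin_phi phi2 nt_phi); apply: eq_bigr => s _.
rewrite -big_split /=; apply: eq_bigr => p _; rewrite /G.
by rewrite [mult_ext (phi * R) _]mult_extMl; ring.
Qed.

Definition quartic_curve_sum B :=
  \sum_s \sum_p mult_ext phi (s ^+ 2 - 4 * p)
    * (mult_ext (phi * B) p * mult_ext phi s * mult_ext phi (1 + s + p)).

(** For [e = 1] the summand depends on [a + b] and [a * b] only. In [sum_pairs], the 1 gives the
    first term and [phi] of the discriminant the second. *)
Lemma triple_sum1 B :
  triple_sum B 1 =
  \sum_s \sum_p mult_ext (phi * B) p * mult_ext phi s * mult_ext phi (1 + s + p)
  + quartic_curve_sum B.
Proof.
pose G s p := mult_ext (phi * B) p * mult_ext phi s * mult_ext phi (1 + s + p).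
transitivity (\sum_a \sum_b G (a + b) (a * b)).
  apply: eq_bigr => a _; apply: eq_bigr => b _; rewrite /G mul1r [b + a]addrC.
  congr (_ * _ * mult_ext phi _); ring.
rewrite (sum_pairs lin_phi phi2 nt_phi) -big_split; apply: eq_bigr => s _ /=.
by rewrite -big_split; apply: eq_bigr => p _ /=; rewrite mulrDl mul1r.
Qed.

(** Summing over [p] first gives [B (1 + s)] times a constant, so the whole is a product of two
    Jacobi sums, in which all cancels but [g phi ^+ 2 = q]. *)
Lemma sum_conic B :
  B \is a linear_char -> B != 1 -> phi * B != 1 -> mult_ext B (-1) = 1 ->
  \sum_s \sum_p mult_ext (phi * B) p * mult_ext phi s * mult_ext phi (1 + s + p)
  = #|F|%:R.
Proof.
move=> linB ntB ntPB BN1.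
have linPB : phi * B \is a linear_char by rewrite rpredM.
have PBP : phi * B * phi = B by rewrite mulrAC -expr2 phi2 mul1r.
transitivity (jacobi phi B * jacobi (phi * B) phi).
  rewrite {1}/jacobi mulr_suml; apply: eq_bigr => s _.
  have := @sum_jacobi_dilate F (phi * B) phi (1 + s) linPB lin_phi.
  rewrite PBP => /(_ ntB) E; rewrite -mulrA -E mulr_sumr.
  by apply: eq_bigr => p _; ring.
rewrite !(jacobiE theta_char) ?PBP // !mult_extMl phiN1 BN1 !mul1r.
transitivity (gauss theta phi ^+ 2); last first.
  by rewrite (gauss_quadratic_sqr theta_char) // phiN1 mul1r.
by field; rewrite !(gauss_neq0 theta_char).
Qed.

(* The twist by p of y^2 = s (1 + s + p) (s^2 - 4 p) becomes
   y^2 = x (c - 2 + 8 x - 4 x^2) with c = p + 1/p, through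
   1/s = (x - 1) / (1 + p), which degenerates at p = -1; the extra phi(p) is
   the point s at infinity. *)
Lemma fibre_cubic p : p != 0 ->
  mult_ext phi p * \sum_s mult_ext phi (s ^+ 2 - 4 * p)
     * (mult_ext phi s * mult_ext phi (1 + s + p)) + mult_ext phi p
  = \sum_x mult_ext phi x * mult_ext phi (p + p^-1 - 2 + 8 * x - 4 * x ^+ 2).
Proof.
move=> nzp.
(* With [r = 1 / s] the quartic in [s] loses the square factor [s ^+ 4]; the new term at [r = 0] is
   the extra [phi p]. *)
have -> : mult_ext phi p * \sum_s mult_ext phi (s ^+ 2 - 4 * p)
     * (mult_ext phi s * mult_ext phi (1 + s + p)) + mult_ext phi p
  = mult_ext phi p * \sum_r mult_ext phi (1 + (1 + p) * r)
       * mult_ext phi (1 - 4 * p * r ^+ 2).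
  rewrite (bigD1 0) //= mult_ext0 mul0r mulr0 add0r.
  rewrite [in RHS](bigD1 0) //= mulr0 addr0 expr0n mulr0 subr0 (mult_ext1 lin_phi).
  rewrite mulr1 mulrDr mulr1 addrC; congr (_ + _ * _).
  rewrite [RHS](reindex_inj invr_inj) /=.
  apply: eq_big => s; rewrite ?invr_eq0 // => nzs.
  rewrite -!mult_extM // -[RHS](quadratic_mulKx lin_phi phi2 _ (expf_neq0 2 nzs)).
  by congr mult_ext; field.
(* At [p = -1] the linear factor in [r] is constant and the cubic on the right is [-4 x (x - 1)^2];
   both sides equal [-1]. *)
have [->|pN1] := eqVneq p (-1).
  rewrite phiN1 mul1r subrr; under eq_bigr => r _ do
    rewrite mul0r addr0 (mult_ext1 lin_phi) mul1r.
  rewrite (reindex_inj (divIf nz2)) /=.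
  transitivity (\sum_z mult_ext phi (1 + z ^+ 2)).
    by apply: eq_bigr => z _; congr mult_ext; field.
  rewrite (sum_sqr lin_phi phi2 nt_phi (fun y => mult_ext phi (1 + y))).
  transitivity (\sum_y mult_ext phi (1 + y) + jacobi phi phi).
    by rewrite -big_split; apply: eq_bigr => y _; rewrite mulrDl mul1r.
  have -> : \sum_y mult_ext phi (1 + y) = 0.
    by rewrite -[RHS]sum_phi [RHS](reindex_inj (addrI 1)).
  have := jacobi_mulV theta_char lin_phi nt_phi.
  rewrite (quadraticVl lin_phi phi2) add0r => ->.
  rewrite (eq_bigr (fun x => mult_ext phi x - (x == 1)%:R)) => [|x _].
    rewrite sumrB sum_phi sub0r (bigD1 1) //= eqxx big1 ?addr0 // => x.
    by move/negPf->.
  rewrite (_ : _ - _ = - (2 * (x - 1)) ^+ 2); last by rewrite invrN1; ring.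
  rewrite phiN; have [->|nzx] := eqVneq x 1.
    by rewrite subrr mulr0 expr0n mult_ext0 mulr0 mult_ext1 // subrr.
  by rewrite quadratic_sqr ?mulr1 ?subr0 // mulf_neq0 ?subr_eq0.
have nzp1 : 1 + p != 0 by rewrite addrC addr_eq0.
have f_inj : injective (fun x => (x - 1) / (1 + p)) by move=> x y /(divIf nzp1)/addIr.
rewrite (reindex_inj f_inj) mulr_sumr; apply: eq_bigr => x _ /=.
rewrite mulrCA (_ : 1 + (1 + p) * _ = x); last by field.
congr (_ * _); rewrite -mult_extM //.
have nzk : (1 + p) / p != 0 by rewrite mulf_neq0 ?invr_eq0.
rewrite -(quadratic_mulKx lin_phi phi2 _ nzk); congr mult_ext.
by field; rewrite nzp nzp1.
Qed.

(** The pairs [x], [k / x] are those of product [k]: this is [sum_pairs] restricted to [p = k]. *)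
Lemma sum_add_inv (k : F) (H : F -> algC) : k != 0 ->
  \sum_(x | x != 0) H (x + k / x)
  = \sum_z (1 + mult_ext phi (z ^+ 2 - 4 * k)) * H z.
Proof.
move=> nzk; pose G s p := (p == k)%:R * H s.
transitivity (\sum_a \sum_b G (a + b) (a * b)).
  rewrite [RHS](bigD1 0) //= [X in _ = X + _]big1 ?add0r => [|b _]; last first.
    by rewrite /G mul0r eq_sym (negPf nzk) mulr0n mul0r.
  apply: eq_bigr => a nza; rewrite [RHS](bigD1 (k / a)) //= big1 => [|b nkb].
    by rewrite addr0 /G mulrCA divff // mulr1 eqxx mul1r.
  rewrite /G (_ : (a * b == k) = false) ?mulr0n ?mul0r //.
  by apply: contraNF nkb => /eqP <-; rewrite mulrAC mulfV ?mul1r.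
rewrite (sum_pairs lin_phi phi2 nt_phi); apply: eq_bigr => s _.
rewrite (bigD1 k) //= big1 ?addr0 /G => [|p /negPf->]; first by rewrite eqxx mul1r.
by rewrite mulr0n mul0r mulr0.
Qed.

(* The 2-isogeny with kernel generated by (0, 0). *)
Lemma fibre_isogeny c :
  \sum_x mult_ext phi x * mult_ext phi (c - 2 + 8 * x - 4 * x ^+ 2)
  = \sum_z mult_ext phi (z + 2) * mult_ext phi (z ^+ 2 + (c - 2)).
Proof.
move: (c - 2) => k; rewrite [RHS](reindex_inj oppr_inj) /=.
have [->|nzk] := eqVneq k 0.
  apply: eq_bigr => x _; have [->|nzx] := eqVneq x 0.
    by rewrite mult_ext0 mul0r oppr0 expr0n /= addr0 mult_ext0 mulr0.
  rewrite !addr0 quadratic_sqr ?oppr_eq0 // mulr1 -mult_extM //.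
  rewrite -[RHS](quadratic_mulKx lin_phi phi2 _ (mulf_neq0 nz2 nzx)).
  by congr mult_ext; ring.
(* With [K = - k / 4] and [v = x + K / x], [x (k + 8 x - 4 x^2) = (2 x)^2 (2 - v)]. The discriminant
   [z^2 - 4 K] in [sum_add_inv] is then [z^2 + k]. *)
have nzK : - k / 4 != 0 by rewrite mulf_neq0 ?oppr_eq0 ?invr_eq0.
rewrite (bigD1 0) //= mult_ext0 mul0r add0r.
have := sum_add_inv (fun v => mult_ext phi (2 - v)) nzK.
set L := (X in X = _ -> _); set L' := (X in _ -> X = _) => E.
have -> : L' = L.
  apply: eq_bigr => x nzx; rewrite -mult_extM //.
  rewrite -[RHS](quadratic_mulKx lin_phi phi2 _ (mulf_neq0 nz2 nzx)).
  by congr mult_ext; field; rewrite nzx nz4.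
transitivity (\sum_z mult_ext phi (2 - z)
    + \sum_z mult_ext phi (- z + 2) * mult_ext phi ((- z) ^+ 2 + k)).
  rewrite E -big_split; apply: eq_bigr => z _ /=.
  rewrite mulrDl mul1r [- z + 2]addrC sqrrN mulrC; congr (_ + _ * mult_ext phi _).
  by field.
rewrite (_ : \sum_z mult_ext phi (2 - z) = 0) ?add0r // -[RHS]sum_phi.
by rewrite [RHS](reindex_inj (addrI 2)) [RHS](reindex_inj oppr_inj).
Qed.

(* The substitution z = y + 1/y turns phi (z + 2) into phi y = chi4 (y^2). *)
Lemma fibre_quartic c :
  \sum_z mult_ext phi (z + 2) * mult_ext phi (z ^+ 2 + (c - 2))
  = \sum_t mult_ext chi4 t * mult_ext phi (c + t + t^-1).
Proof.
set L := LHS; set N := RHS; pose G v := mult_ext phi (c + v).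
have nz1 : 1 != 0 :> F by rewrite oner_eq0.
(* [Q] is computed twice: through [t = y^2] it is [N + N], through [z = y + 1 / y] it is [L + L]. *)
pose Q := \sum_y mult_ext phi y * G (y ^+ 2 + (y ^+ 2)^-1).
have EQ2 : Q = N + N.
  transitivity (\sum_y mult_ext chi4 (y ^+ 2) * G (y ^+ 2 + (y ^+ 2)^-1)).
    apply: eq_bigr => y _; congr (_ * _); have [->|nzy] := eqVneq y 0.
      by rewrite expr0n !mult_ext0.
    by rewrite mult_extX // -mult_extXl // chi4_sqr.
  rewrite (sum_sqr lin_phi phi2 nt_phi (fun t => mult_ext chi4 t * G (t + t^-1))).
  (* The [phi] part of [sum_sqr] carries [phi * chi4 = chi4^-1], so it is [N] after inverting
     [t]. *)
  have {2}-> : N = \sum_t mult_ext chi4 t^-1 * mult_ext phi (c + t^-1 + t).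
    by rewrite /N (reindex_inj invr_inj); apply: eq_bigr => t _ /=; rewrite invrK.
  rewrite -big_split; apply: eq_bigr => t _ /=.
  rewrite /G mulrDl mul1r !addrA; congr (_ + _).
  rewrite [c + t^-1 + t]addrAC mulrA mult_extV // -mult_extMl; congr (_ * _).
  rewrite -mult_extVl //; congr mult_ext; apply: (mulIr (lin_char_unitr lin_chi4)).
  by rewrite mulVr ?lin_char_unitr // -mulrA -expr2 chi4_sqr -expr2 phi2.
have EQL : Q = L + L.
  have := sum_add_inv (fun z => mult_ext phi (z + 2) * G (z ^+ 2 - 2)) nz1.
  (* As [y + 1 / y + 2 = (y + 1)^2 / y], its [phi] is [phi y] except at [y = -1], where it is 0 and
     [Q] has the term [G 2]. *)
  have -> : \sum_(y | y != 0) mult_ext phi (y + 1 / y + 2) * G ((y + 1 / y) ^+ 2 - 2)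
     = Q - G 2.
    have -> : Q = \sum_(y | y != 0) mult_ext phi y * G (y ^+ 2 + (y ^+ 2)^-1).
      by rewrite /Q (bigD1 0) //= mult_ext0 mul0r add0r.
    have nzN1 : -1 != 0 :> F by rewrite oppr_eq0.
    rewrite [in LHS](bigD1 (-1)) // [in RHS](bigD1 (-1)) //=.
    rewrite (_ : -1 + 1 / -1 + 2 = 0); last by rewrite invrN1; ring.
    rewrite mult_ext0 mul0r add0r phiN1 sqrrN expr1n invr1 mul1r addrAC subrr add0r.
    apply: eq_bigr => y /andP[nzy nyN1].
    have nzk : (y + 1) / y != 0 by rewrite mulf_neq0 ?invr_eq0 // addr_eq0.
    rewrite -[mult_ext phi y](quadratic_mulKx lin_phi phi2 _ nzk).
    by congr (mult_ext phi _ * G _); field.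
  have LN : \sum_z mult_ext phi (z - 2) * G (z ^+ 2 - 2) = L.
    rewrite /L [RHS](reindex_inj oppr_inj) /=; apply: eq_bigr => z _.
    rewrite (_ : - z + 2 = - (z - 2)); last by ring.
    by rewrite phiN sqrrN /G; congr (_ * mult_ext phi _); ring.
  (* The same correction [G 2] arises at [z = -2], where the square [(z + 2) ^+ 2] is 0 and cannot
     be dropped. *)
  have -> : \sum_z (1 + mult_ext phi (z ^+ 2 - 4 * 1))
      * (mult_ext phi (z + 2) * G (z ^+ 2 - 2)) = L + L - G 2.
    rewrite -{2}LN (_ : G 2 = \sum_(z : F) G 2 *+ (z == -2)); last first.
      by rewrite (bigD1 (-2)) //= eqxx big1 ?addr0 // => z /negPf->.
    rewrite -addrA -sumrB -big_split; apply: eq_bigr => z _ /=.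
    rewrite mulrDl mul1r; congr (_ + _).
      by rewrite /G; congr (_ * mult_ext phi _); ring.
    rewrite mulrA -mult_extM // (_ : (z ^+ 2 - 4 * 1) * (z + 2)
      = (z + 2) ^+ 2 * (z - 2)); last by ring.
    have [->|nz] := eqVneq z (-2).
      rewrite addNr expr0n mul0r mult_ext0 mul0r mulr1n.
      rewrite (_ : -2 - 2 = - 2 ^+ 2); last by ring.
      rewrite phiN quadratic_sqr // mul1r (_ : (-2) ^+ 2 - 2 = 2) ?subrr //; ring.
    by rewrite mulr0n subr0 quadratic_mulKx // addr_eq0.
  by move/addIr.
have /eqP : L *+ 2 = N *+ 2 by rewrite !mulr2n -EQL.
by rewrite eqrMn2r => /eqP.
Qed.

End QuarticSums.

(** * The [B]-weighted sum over the elliptic fibres *)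

Section MellinTransform.

Variables (F : finFieldType) (theta : F -> algC).
Hypothesis theta_char : nontrivial_additive_char theta.
Implicit Types (A B S : mult_classfun F) (p s t v w x y z : F).
Variables phi chi4 : mult_classfun F.
Hypotheses (lin_phi : phi \is a linear_char) (phi2 : phi ^+ 2 = 1).
Hypotheses (nt_phi : phi != 1) (phiN1 : mult_ext phi (-1) = 1).
Hypotheses (lin_chi4 : chi4 \is a linear_char) (chi4_sqr : chi4 ^+ 2 = phi).

Local Notation g := (gauss theta).
Local Notation q := (#|F|%:R : algC).

Lemma quartic_curve_sumE B : B \is a linear_char -> phi * B != 1 ->
  quartic_curve_sum phi B
  = \sum_w \sum_t mult_ext B w
      * (mult_ext chi4 t * mult_ext phi (w + w^-1 + t + t^-1)).
Proof.
move=> linB ntPB; rewrite /quartic_curve_sum exchange_big /=.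
(* Adding this zero sum supplies, with weight [B p], the extra [phi p] of [fibre_cubic]. *)
have S0 : \sum_p mult_ext (phi * B) p = 0 by rewrite sum_mult_ext ?rpredM.
rewrite -[LHS]addr0 -[X in _ + X]S0 -big_split; apply: eq_bigr => p _ /=.
have [->|nzp] := eqVneq p 0.
  rewrite !mult_ext0 addr0 big1 => [|s _]; last by rewrite mul0r mul0r mulr0.
  by rewrite big1 // => t _; rewrite mul0r.
rewrite -mulr_sumr -(fibre_quartic lin_phi phi2 nt_phi phiN1 lin_chi4 chi4_sqr).
rewrite -(fibre_isogeny lin_phi phi2 nt_phi).
rewrite -(fibre_cubic lin_phi phi2 nt_phi phiN1 theta_char nzp).
rewrite mulrDr mulrA mult_extMl mulr_sumr; congr (_ + _); last by rewrite mulrC.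
by apply: eq_bigr => s _; ring.
Qed.

Lemma quartic_curve_sum_odd B : B \is a linear_char -> phi * B != 1 ->
  mult_ext B (-1) = 1 -> mult_ext chi4 (-1) = -1 -> quartic_curve_sum phi B = 0.
Proof.
move=> linB ntPB BN1 chi4N1; rewrite quartic_curve_sumE //.
set W := LHS; have : W = - W.
  rewrite {1}/W (reindex_inj oppr_inj) -sumrN; apply: eq_bigr => w _ /=.
  rewrite (reindex_inj oppr_inj) -sumrN; apply: eq_bigr => t _ /=.
  rewrite -[in mult_ext B _]mulN1r -[in mult_ext chi4 _]mulN1r !mult_extM // BN1 chi4N1.
  rewrite -[in LHS](quadraticN lin_phi phiN1).
  rewrite (_ : - (- w + _ + _ + _) = w + w^-1 + t + t^-1).
    by ring.
  by rewrite !invrN; ring.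
by move/eqP; rewrite -addr_eq0 -mulr2n mulrn_eq0 => /eqP.
Qed.

(* With w = t v and x = t^2 v the sum splits into a product in v and x, up to the
   constraint that v x be a square. *)
Lemma quartic_curve_sum_even A S : A \is a linear_char -> S \is a linear_char ->
  S ^+ 2 = chi4 -> A ^+ 8 != 1 ->
  quartic_curve_sum phi (A ^+ 2)
  = jacobi (phi * A * S) phi * jacobi (A * S^-1) phi
    + jacobi (A * S) phi * jacobi (phi * A * S^-1) phi.
Proof.
move=> linA linS S2 ntA.
have linA2 : A ^+ 2 \is a linear_char by rewrite rpredX.
have linVS : S^-1 \is a linear_char by rewrite rpredVr.
have linAVS : A * S^-1 \is a linear_char by rewrite rpredM.
have ntPA : phi * A ^+ 2 != 1.
  apply: contraNneq ntA => PA1.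
  have <- : (phi * A ^+ 2) ^+ 4 = A ^+ 8.
    by rewrite exprMn -(exprM A 2 4) (exprM phi 2 2) phi2 expr1n mul1r.
  by rewrite PA1 expr1n.
rewrite quartic_curve_sumE // exchange_big /=.
transitivity (\sum_t \sum_v mult_ext (phi * A ^+ 2) v * mult_ext phi (1 + v)
    * (mult_ext (A * S^-1) (t ^+ 2) * mult_ext phi (1 + t ^+ 2 * v))).
  apply: eq_bigr => t _; have [->|nzt] := eqVneq t 0.
    rewrite !big1 // => v _; last by rewrite mult_ext0 mul0r mulr0.
    by rewrite expr0n mult_ext0 mul0r mulr0.
  rewrite (reindex_inj (mulfI nzt)) /=; apply: eq_bigr => v _.
  have [->|nzv] := eqVneq v 0; first by rewrite mulr0 !mult_ext0 !mul0r.
  have nztv : t * v != 0 by rewrite mulf_neq0.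
  (* For [w = t v], [(t v)^2 (w + 1 / w + t + 1 / t)] factors as [t v (1 + v) (1 + t^2 v)]. *)
  rewrite -(quadratic_mulKx lin_phi phi2 (_ + _) nztv).
  rewrite (_ : _ * (_ + _) = v * t * (1 + v) * (1 + t ^+ 2 * v)); last first.
    by field; rewrite nzt nzv.
  (* [phi * chi4 = S ^+ 6] is the inverse of [S ^+ 2], so [t] enters only through [t ^+ 2]. *)
  have SVt : mult_ext phi t * mult_ext chi4 t = (mult_ext S t)^-1 ^+ 2.
    have St : mult_ext S t != 0 by rewrite mult_ext_neq0.
    have St8 : mult_ext S t ^+ 8 = 1.
      rewrite -mult_extXl // (exprM S 2 4) S2 (exprM chi4 2 2) chi4_sqr phi2.
      by rewrite mult_ext_triv nzt.
    apply: (mulIf (expf_neq0 2 St)); rewrite -exprMn mulVf // expr1n -chi4_sqr -S2.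
    by rewrite !mult_extXl // -St8; ring.
  rewrite !mult_extM // !mult_extMl mult_extVl //.
  transitivity (mult_ext phi t * mult_ext chi4 t * (mult_ext A t ^+ 2
    * mult_ext A v ^+ 2 * mult_ext phi v * mult_ext phi (1 + v)
    * mult_ext phi (1 + t ^+ 2 * v))); first by ring.
  by rewrite SVt; ring.
rewrite exchange_big /=.
transitivity (\sum_v \sum_x (mult_ext (phi * A * S) v * mult_ext phi (1 + v)
      * (mult_ext (A * S^-1) x * mult_ext phi (1 + x))
    + mult_ext (A * S) v * mult_ext phi (1 + v)
      * (mult_ext (phi * A * S^-1) x * mult_ext phi (1 + x)))).
  apply: eq_bigr => v _; rewrite -mulr_sumr.
  have [->|nzv] := eqVneq v 0.
    by rewrite !mult_ext0 !mul0r big1 // => x _; rewrite !mul0r addr0.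
  (* The factor [1 + phi] from [sum_sqr] detects the constraint; its two terms give the two
     products. *)
  rewrite (sum_sqr lin_phi phi2 nt_phi
    (fun x => mult_ext (A * S^-1) x * mult_ext phi (1 + x * v))).
  rewrite (reindex_inj (mulIf (invr_neq0 nzv))) mulr_sumr.
  apply: eq_bigr => x _ /=; rewrite divfK // mult_extM //.
  rewrite [mult_ext (A * S^-1) (x / v)]mult_extM //.
  have Av : mult_ext A v != 0 by rewrite mult_ext_neq0.
  have Sv : mult_ext S v != 0 by rewrite mult_ext_neq0.
  have pv : mult_ext phi v ^+ 2 = 1 by rewrite quadraticX.
  rewrite quadraticV // [mult_ext (A * S^-1) v^-1]mult_extV //.
  rewrite !mult_extMl !mult_extVl //.
  set a := mult_ext A v; set b := mult_ext S v; set c := mult_ext phi v.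
  rewrite -/a -/b -/c in Av Sv pv.
  set d := mult_ext A x; set e := mult_ext S x; set f := mult_ext phi x.
  transitivity (c * a * b * mult_ext phi (1 + v) * (d / e * mult_ext phi (1 + x))
    + c ^+ 2 * (a * b * mult_ext phi (1 + v) * (f * d / e * mult_ext phi (1 + x)))).
    (* [e] is 0 at [x = 0], where the convention [0^-1 = 0] keeps the identity true. *)
    have [->|e0] := eqVneq e 0; last by field; rewrite Av Sv e0.
    by rewrite invr0; field; rewrite Av Sv.
  by rewrite pv mul1r.
rewrite /jacobi !big_distrl -big_split; apply: eq_bigr => v _ /=.
by rewrite !big_distrr -big_split.
Qed.

End MellinTransform.

(** * Summation over all characters, and the value of [chi4] at [-1] *)

Section CharacterSums.

Variable F : finFieldType.
Implicit Types (A B S X : mult_classfun F) (u v w x : F).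
Variables phi chi4 : mult_classfun F.
Hypotheses (lin_phi : phi \is a linear_char) (phi2 : phi ^+ 2 = 1).
Hypotheses (nt_phi : phi != 1) (phiN1 : mult_ext phi (-1) = 1).
Hypotheses (lin_chi4 : chi4 \is a linear_char) (chi4_sqr : chi4 ^+ 2 = phi).

Local Notation q := (#|F|%:R : algC).

Let nzN1 : -1 != 0 :> F. Proof. by rewrite oppr_eq0 oner_eq0. Qed.

Lemma neqN11 : -1 != 1 :> F.
Proof.
by rewrite eq_sym -addr_eq0 -mulr2n (two_neq0 lin_phi phi2 nt_phi).
Qed.

Lemma natr_card_sub1_neq0 : q - 1 != 0.
Proof.
rewrite -natr_card_predF pnatr_eq0 -(cardC1 (0 : F)) (cardD1 1) !inE.
by rewrite oner_eq0.
Qed.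

Lemma sum_sqr_eq1 (f : F -> algC) :
  \sum_x f x *+ (x ^+ 2 == 1) = f 1 + f (-1).
Proof.
rewrite (bigD1 1) //= (bigD1 (-1)) ?neqN11 //= big1 => [|x /andP[x1 xN1]].
  by rewrite addr0 sqrrN expr1n eqxx.
by rewrite sqrf_eq1 (negPf x1) (negPf xN1).
Qed.

(** Without a square root, every [chi4^-1 * 'chi_i ^+ 2] is nontrivial and the double sum of their
    values is 0; summing over [i] first gives [2 (q - 1)] instead. *)
Lemma quartic_square_root : mult_ext chi4 (-1) = 1 ->
  exists i : mult_Iirr F, 'chi_i ^+ 2 = chi4.
Proof.
move=> chi4N1.
have [/existsP[i /eqP]|] := boolP [exists i : mult_Iirr F, 'chi_i ^+ 2 == chi4].
  by exists i.
rewrite negb_exists => /forallP nsq.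
have linV : chi4^-1 \is a linear_char by rewrite rpredVr.
have : \sum_(i : mult_Iirr F) \sum_x mult_ext (chi4^-1 * 'chi_i ^+ 2) x = 0.
  rewrite big1 // => i _; have lini := irr_mult_linear i.
  rewrite sum_mult_ext ?rpredM ?rpredX //; apply: contra (nsq i) => /eqP E.
  by rewrite -[_ ^+ 2](mulKr (lin_char_unitr linV)) E invrK mulr1.
rewrite exchange_big /=.
rewrite (eq_bigr (fun x => mult_ext chi4^-1 x * (q - 1) *+ (x ^+ 2 == 1))); last first.
  move=> x _; rewrite -mulrnAr -sum_irr_mult_ext mulr_sumr; apply: eq_bigr => i _.
  have [->|nzx] := eqVneq x 0; first by rewrite !mult_ext0 mul0r.
  by rewrite mult_extMl mult_extXl // mult_extX // irr_mult_linear.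
rewrite sum_sqr_eq1 !mult_extVl // chi4N1 mult_ext1 // invr1 !mul1r -mulr2n.
by move/eqP; rewrite mulrn_eq0 /= (negPf natr_card_sub1_neq0).
Qed.

(** For [q = 4 m + 1] and a generator [u], [-1 = u ^+ (2 m)] and [chi4 u ^+ 2 = -1], so the value is
    [(-1)^m]. *)
Lemma quarticN1 : (#|F| = 1 %[mod 4])%N ->
  mult_ext chi4 (-1) = if #|F| == 1 %[mod 8] then 1 else -1.
Proof.
move=> q4; have [u [gen_u ord_u]] := mult_generator F.
have chi4u : chi4 u ^+ 2 = -1.
  by rewrite -expS_cfunE chi4_sqr (quadratic_generator lin_phi phi2 nt_phi).
pose m := (#|F| %/ 4)%N.
have qE : #|F| = (m * 4).+1 by rewrite [LHS](divn_eq _ 4) q4 addn1.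
have -> : (-1 : F) = val (u ^+ (m * 2))%g.
  apply/esym/eqP; have := sqrf_eq1 (val (u ^+ (m * 2))%g).
  rewrite -FinRing.val_unitX -expgM -mulnA.
  have -> : (u ^+ (m * (2 * 2)) = 1)%g.
    by have := expg_order u; rewrite ord_u qE.
  rewrite FinRing.val_unit1 eqxx => /esym/orP[|//]; rewrite -FinRing.val_unit1.
  rewrite (inj_eq val_inj) -order_dvdn ord_u qE /=.
  have [m0|m_gt0] := posnP m.
    by have := natr_card_sub1_neq0; rewrite qE m0 mul0n subrr eqxx.
  by move/dvdn_leq; rewrite muln_gt0 m_gt0 leq_pmul2l // => /(_ isT).
rewrite mult_ext_unit lin_charX ?inE // mulnC exprM chi4u -signr_odd.
have -> : (#|F| == 1 %[mod 8]) = ~~ odd m.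
  by rewrite qE -addn1 -[in RHS]dvdn2 -(@dvdn_pmul2r 4) // (eqn_modDr 1 _ 0).
by case: (odd m); rewrite ?expr1 ?expr0.
Qed.

(** Expanding the Jacobi sums over [u], [v], [w], orthogonality applied to the values at [(u v w)^2]
    leaves [u v w = 1] and [u v w = -1], one for each [triple_sum]. *)
Lemma sum_irr_jacobi B : B \is a linear_char ->
  \sum_(i : mult_Iirr F) jacobi (phi * 'chi_i ^+ 2) phi
     * jacobi (phi * (B * 'chi_i ^+ 2)) phi * jacobi (phi * (B^-1 * 'chi_i ^+ 2)) phi
  = (q - 1) * (triple_sum phi B 1 + triple_sum phi B (-1)).
Proof.
move=> linB; pose f u := mult_ext phi u * mult_ext phi (1 + u).
have tripleE (e : F) : mult_ext phi e = 1 ->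
  \sum_w \sum_v f v * f w * mult_ext B v / mult_ext B w * f (e / (v * w))
  = triple_sum phi B e.
  move=> phi_e; rewrite /triple_sum [LHS](reindex_inj invr_inj) /=.
  apply: eq_bigr => w _; apply: eq_bigr => v _; rewrite /f.
  have [->|nzw] := eqVneq w 0; first by rewrite invr0 mul0r !mult_ext0 !(mul0r, mulr0).
  have [->|nzv] := eqVneq v 0; first by rewrite mulr0 !mult_ext0 !mul0r.
  have -> : mult_ext phi w^-1 * mult_ext phi (1 + w^-1) = mult_ext phi (1 + w).
    rewrite -mult_extM // -[LHS](quadratic_mulKx lin_phi phi2 _ nzw).
    by congr mult_ext; field.
  have -> : mult_ext phi (e / (v / w)) * mult_ext phi (1 + e / (v / w))
     = mult_ext phi w * mult_ext phi (v + e * w).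
    rewrite -mult_extM // -[LHS](quadratic_mulKx lin_phi phi2 _ nzv).
    rewrite -[mult_ext phi w]mul1r -phi_e -!mult_extM //.
    by congr mult_ext; field; rewrite nzv nzw.
  by rewrite mult_extV // invrK mult_extMl !mult_extM //; ring.
transitivity (\sum_w \sum_v f v * f w * mult_ext B v / mult_ext B w
   * ((q - 1) * (f (1 / (v * w)) + f (-1 / (v * w))))); last first.
  rewrite -!tripleE ?mult_ext1 // -big_split mulr_sumr; apply: eq_bigr => w _.
  by rewrite -big_split mulr_sumr; apply: eq_bigr => v _ /=; ring.
pose g (i : mult_Iirr F) w v u := f v * f w * mult_ext B v / mult_ext B w
  * (f u * mult_ext 'chi_i ((u * v * w) ^+ 2)).
transitivity (\sum_(i : mult_Iirr F) \sum_w \sum_v \sum_u g i w v u).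
  apply: eq_bigr => i _; have lini := irr_mult_linear i.
  rewrite {3}/jacobi mulr_sumr; apply: eq_bigr => w _.
  rewrite {2}/jacobi mulr_sumr mulr_suml; apply: eq_bigr => v _.
  rewrite /jacobi !mulr_suml; apply: eq_bigr => u _; rewrite /g /f.
  have [->|nzu] := eqVneq u 0; first by rewrite !mult_ext0 !(mul0r, mulr0).
  have [->|nzv] := eqVneq v 0; first by rewrite !mult_ext0 !(mul0r, mulr0).
  have [->|nzw] := eqVneq w 0; first by rewrite !mult_ext0 !(mul0r, mulr0).
  rewrite mult_extX // !mult_extM // !mult_extMl mult_extVl //.
  by ring.
rewrite exchange_big; apply: eq_bigr => w _.
rewrite exchange_big; apply: eq_bigr => v _.
rewrite exchange_big /g /=.
have [->|nzv] := eqVneq v 0.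
  by rewrite big1 => [|u _]; rewrite ?big1 // => *; rewrite /f mult_ext0 !mul0r.
have [->|nzw] := eqVneq w 0.
  by rewrite big1 => [|u _]; rewrite ?big1 // => *;
     rewrite /f mult_ext0 mul0r mulr0 !mul0r.
have nzvw : v * w != 0 by rewrite mulf_neq0.
rewrite -(sum_sqr_eq1 (fun x => f (x / (v * w)))) !mulr_sumr.
rewrite (reindex_inj (divIf nzvw)); apply: eq_bigr => x _ /=.
rewrite -!mulr_sumr sum_irr_mult_ext (_ : x / (v * w) * v * w = x).
  by rewrite !mulrnAr; congr (_ *+ _); ring.
by field; rewrite nzv nzw.
Qed.

End CharacterSums.

(** * Assembly in terms of Gauss sums *)

Section Evaluation.

Variables (F : finFieldType) (theta : F -> algC).
Hypothesis theta_char : nontrivial_additive_char theta.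
Variables phi chi4 A : mult_classfun F.
Hypotheses (lin_phi : phi \is a linear_char) (phi2 : phi ^+ 2 = 1).
Hypotheses (nt_phi : phi != 1) (phiN1 : mult_ext phi (-1) = 1).
Hypotheses (lin_chi4 : chi4 \is a linear_char) (chi4_sqr : chi4 ^+ 2 = phi).
Hypotheses (linA : A \is a linear_char) (ntA8 : A ^+ 8 != 1).

Local Notation g := (gauss theta).
Local Notation q := (#|F|%:R : algC).

Lemma chi4V : chi4^-1 = phi * chi4.
Proof.
apply: (mulIr (lin_char_unitr lin_chi4)).
by rewrite mulVr ?lin_char_unitr // -mulrA -expr2 chi4_sqr -expr2 phi2.
Qed.

(** With [X1 = S A] and [X2 = chi4 S A], the Jacobi sums involve only [X1], [X2] and their products
    with [phi], all nontrivial as their eighth power is [A ^+ 8]. [E (phi * S)] is the inverse of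
    [E S]. *)
Lemma quartic_curve_sum_gauss (S : mult_classfun F) :
  S \is a linear_char -> S ^+ 2 = chi4 ->
  let E := fun S => g (S * A) * g (chi4 * S * A)
             / (g (phi * S * A) * g (chi4^-1 * S * A)) in
  quartic_curve_sum phi (A ^+ 2) = q * (E S + E (phi * S)).
Proof.
move=> linS S2 /=; have US := lin_char_unitr linS.
have S8 : S ^+ 8 = 1 by rewrite (exprM S 2 4) S2 (exprM chi4 2 2) chi4_sqr phi2.
have SV : S^-1 = phi * chi4 * S.
  apply: (mulIr US); rewrite mulVr // -[RHS]mulrA -expr2 S2 -mulrA -expr2.
  by rewrite chi4_sqr -expr2 phi2.
have nt8 X : X ^+ 8 = A ^+ 8 -> X != 1.
  by move=> X8; apply: contraNneq ntA8 => X1; rewrite -X8 X1 expr1n.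
have chi48 : chi4 ^+ 8 = 1.
  by rewrite (exprM chi4 2 4) chi4_sqr (exprM phi 2 2) phi2 expr1n.
have phi8 : phi ^+ 8 = 1 by rewrite (exprM phi 2 4) phi2 expr1n.
have linP X : X \is a linear_char -> phi * X \is a linear_char by apply: rpredM.
rewrite (quartic_curve_sum_even theta_char lin_phi phi2 nt_phi phiN1 lin_chi4 chi4_sqr
  linA linS S2 ntA8) SV chi4V.
have phiphi X : phi * X * phi = X by rewrite mulrAC -expr2 phi2 mul1r.
set X1 := S * A; set X2 := chi4 * S * A.
have linX1 : X1 \is a linear_char by rewrite rpredM.
have linX2 : X2 \is a linear_char by rewrite !rpredM.
have ntX1 : X1 != 1 by apply: nt8; rewrite exprMn S8 mul1r.
have ntX2 : X2 != 1 by apply: nt8; rewrite !exprMn S8 chi48 !mul1r.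
have ntPX1 : phi * X1 != 1 by apply: nt8; rewrite !exprMn S8 phi8 !mul1r.
have ntPX2 : phi * X2 != 1 by apply: nt8; rewrite !exprMn S8 chi48 phi8 !mul1r.
have -> : phi * A * S = phi * X1 by rewrite /X1; ring.
have -> : A * (phi * chi4 * S) = phi * X2 by rewrite /X2; ring.
have -> : A * S = X1 by rewrite mulrC.
have -> : phi * A * (phi * chi4 * S) = phi ^+ 2 * X2 by rewrite /X2; ring.
have -> : chi4 * (phi * S) * A = phi * X2 by rewrite /X2; ring.
have -> : phi * (phi * S) * A = phi ^+ 2 * X1 by rewrite /X1; ring.
have -> : phi * S * A = phi * X1 by rewrite /X1; ring.
have -> : phi * chi4 * S * A = phi * X2 by rewrite /X2; ring.
have -> : phi * chi4 * (phi * S) * A = phi ^+ 2 * X2 by rewrite /X2; ring.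
rewrite phi2 !mul1r.
rewrite !(jacobiE theta_char) ?phiphi ?[_ * phi]mulrC ?linP //.
have sgn : mult_ext X1 (-1) * mult_ext X2 (-1) = 1.
  rewrite -mult_extMl (_ : X1 * X2 = S ^+ 2 * chi4 * A ^+ 2); last first.
    by rewrite /X1 /X2; ring.
  rewrite S2 -expr2 chi4_sqr mult_extMl phiN1 mul1r mult_extXl ?oppr_eq0 ?oner_eq0 //.
  by rewrite -mult_extX // sqrrN expr1n mult_ext1.
have gX1 := gauss_neq0 theta_char linX1; have gX2 := gauss_neq0 theta_char linX2.
have gPX1 := gauss_neq0 theta_char (linP _ linX1).
have gPX2 := gauss_neq0 theta_char (linP _ linX2).
have := gauss_quadratic_sqr theta_char lin_phi phi2 nt_phi.
rewrite phiN1 mul1r => <-; rewrite ![mult_ext (phi * _) _]mult_extMl phiN1 !mul1r.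
transitivity (mult_ext X1 (-1) * mult_ext X2 (-1) * (g phi ^+ 2 *
  (g X1 * g X2 / (g (phi * X1) * g (phi * X2)) +
   g (phi * X1) * g (phi * X2) / (g X1 * g X2)))).
  by field; rewrite gX1 gX2 gPX1 gPX2.
by rewrite sgn mul1r.
Qed.

Local Notation B := (A ^+ 2).
Let linB : B \is a linear_char. Proof. exact: rpredX. Qed.
Let BN1 : mult_ext B (-1) = 1.
Proof.
rewrite mult_extXl ?oppr_eq0 ?oner_eq0 // -mult_extX //.
by rewrite sqrrN expr1n mult_ext1.
Qed.
(** Serves for [B], [phi * B] and [phi * B * R] with [R ^+ 2 = phi]. *)
Let ntX X : X ^+ 4 = A ^+ 8 -> X != 1.
Proof. by move=> X4; apply: contraNneq ntA8 => X1; rewrite -X4 X1 expr1n. Qed.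
Let B4 : B ^+ 4 = A ^+ 8. Proof. by rewrite -exprM. Qed.
Let phi4 : phi ^+ 4 = 1. Proof. by rewrite (exprM phi 2 2) phi2 expr1n. Qed.
Let chi44 : chi4 ^+ 4 = 1. Proof. by rewrite (exprM chi4 2 2) chi4_sqr. Qed.
Let ntB : B != 1. Proof. exact: ntX. Qed.
Let ntPB : phi * B != 1. Proof. by apply: ntX; rewrite exprMn phi4 mul1r. Qed.

(** The square roots of [phi] are [chi4] and [phi * chi4], one for each Selberg sum of
    [triple_sumN1]. *)
Lemma triple_sumN1_gauss :
  triple_sum phi B (-1)
  = q * \sum_(i : mult_Iirr F | 'chi_i ^+ 2 == phi)
          (let R := 'chi_i in
           g (R^-1 * phi * A ^+ 2) * g (R^-1 * phi * A^-1 ^+ 2) / g R^-1 ^+ 2).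
Proof.
have linPchi4 : phi * chi4 \is a linear_char by rewrite rpredM.
have Pchi4_sqr : (phi * chi4) ^+ 2 = phi by rewrite exprMn phi2 mul1r.
have Pchi44 : (phi * chi4) ^+ 4 = 1 by rewrite exprMn phi4 chi44 mulr1.
rewrite (triple_sumN1 lin_phi phi2 nt_phi B lin_chi4 chi4_sqr).
pose H (R : mult_classfun F) :=
  g (R^-1 * phi * A ^+ 2) * g (R^-1 * phi * A^-1 ^+ 2) / g R^-1 ^+ 2.
have := sum_irr_sqr_eq lin_phi phi2 nt_phi H lin_chi4; rewrite chi4_sqr => ->.
rewrite !(selberg_gauss theta_char lin_phi phi2 nt_phi phiN1) //; last first.
- by apply: ntX; rewrite exprMn chi44 mulr1 exprMn phi4 mul1r.
- by apply: ntX; rewrite exprMn Pchi44 mulr1 exprMn phi4 mul1r.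
by rewrite mulrDr /H exprVn.
Qed.

(** The conic contributes the 1. The residue of [q] mod 8 fixes the sign of [chi4] at [-1]: a square
    root [S] exists if it is positive, and the curve sum vanishes if it is negative. *)
Lemma triple_sum1_gauss : (#|F| = 1 %[mod 4])%N ->
  triple_sum phi B 1
  = q * (1 + if #|F| == 1 %[mod 8] then
         \sum_(i : mult_Iirr F | 'chi_i ^+ 2 == chi4)
           (let S := 'chi_i in
            g (S * A) * g (chi4 * S * A)
            / (g (phi * S * A) * g (chi4^-1 * S * A)))
       else 0).
Proof.
move=> q4; rewrite (triple_sum1 lin_phi phi2 nt_phi).
rewrite (sum_conic lin_phi phi2 nt_phi phiN1 theta_char) // mulrDr mulr1; congr (_ + _).
have := quarticN1 lin_phi phi2 nt_phi lin_chi4 chi4_sqr q4; case: ifP => _ chi4N1.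
  have [i S2] := quartic_square_root lin_phi phi2 nt_phi lin_chi4 chi4N1.
  rewrite (quartic_curve_sum_gauss (irr_mult_linear i) S2).
  pose H (S : mult_classfun F) := g (S * A) * g (chi4 * S * A)
    / (g (phi * S * A) * g (chi4^-1 * S * A)).
  have := sum_irr_sqr_eq lin_phi phi2 nt_phi H (irr_mult_linear i).
  by rewrite S2 => ->.
rewrite mulr0.
exact: (quartic_curve_sum_odd theta_char lin_phi phi2 nt_phi phiN1 lin_chi4 chi4_sqr).
Qed.

Let h (X : mult_classfun F) := jacobi (phi * X) phi.

Let h1 : h 1 = -1.
Proof.
have := jacobi_mulV theta_char lin_phi nt_phi.
by rewrite (quadraticVl lin_phi phi2) /h mulr1.
Qed.

(** The reflection formula at [B] and at [phi * B] gives [q ^+ 2], divided by [g phi ^+ 2 = q]. *)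
Let hB : h B * h B^-1 = q.
Proof.
have linVB : B^-1 \is a linear_char by rewrite rpredVr.
have linPB : phi * B \is a linear_char by rewrite rpredM.
rewrite /h !(jacobi_quadratic theta_char lin_phi phi2 nt_phi) // invrK.
have E1 := gauss_mulV theta_char linB ntB.
have := gauss_mulV theta_char linPB ntPB.
rewrite invrM ?lin_char_unitr // (quadraticVl lin_phi phi2) mult_extMl phiN1 BN1.
rewrite [B^-1 * _]mulrC => E2; rewrite BN1 in E1.
have := gauss_quadratic_sqr theta_char lin_phi phi2 nt_phi; rewrite phiN1 mul1r => E3.
have gp := gauss_neq0 theta_char lin_phi; have q0 := natr_card_neq0 F.
transitivity ((g B * g B^-1) * (g (phi * B) * g (phi * B^-1)) / g phi ^+ 2).
  by field.
by rewrite E1 E2 E3; field.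
Qed.

(** Each block of four Gauss sums is [k * h] of a square. The constants [k] cancel, and the
    denominators multiply to [h 1 * h B * h B^-1 = - q]. *)
Lemma hypergeometric_triple_sum :
  hypergeometric theta
    [tuple chi4; chi4^-1; chi4 * A; chi4^-1 * A; chi4 * A^-1; (chi4 * A)^-1]
    [tuple 1; phi; A^-1; phi * A^-1; A; phi * A]
    1
  = (triple_sum phi B 1 + triple_sum phi B (-1)) / q.
Proof.
pose n (X : mult_classfun F) :=
  g (chi4 * X) * g (chi4^-1 * X) * (g X^-1 * g (phi * X^-1)).
pose k := (mult_ext chi4 4)^-1 * g phi ^+ 3.
have nE X : X \is a linear_char -> n X = k * h (X ^+ 2).
  by move=> linX; rewrite /n (gauss_quartic theta_char lin_phi phi2 nt_phi).
have UA := lin_char_unitr linA; have Uchi4 := lin_char_unitr lin_chi4.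
have linVA : A^-1 \is a linear_char by rewrite rpredVr.
have phiV := quadraticVl lin_phi phi2.
have phiXV X : X \is a linear_char -> (phi * X)^-1 = phi * X^-1.
  by move=> linX; rewrite invrM ?lin_char_unitr // phiV mulrC.
have nzk : k != 0.
  rewrite mulf_neq0 ?invr_eq0 ?expf_neq0 ?(gauss_neq0 theta_char) //.
  by rewrite mult_ext_neq0 // (four_neq0 lin_phi).
have q0 := natr_card_neq0 F; have q1 := natr_card_sub1_neq0 F.
rewrite /hypergeometric.
rewrite (eq_bigr (fun i => (- q)^-1 * (h ('chi_i ^+ 2) * h (B * 'chi_i ^+ 2)
   * h (B^-1 * 'chi_i ^+ 2)))).
  rewrite -mulr_sumr (sum_irr_jacobi lin_phi phi2 nt_phi phiN1 linB).
  by field; rewrite q0 q1.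
move=> i _; have lini := irr_mult_linear i; set X := 'chi_i in lini *.
rewrite mult_ext1 // mulr1 (exprM _ 2 3) -mult_extX // sqrrN expr1n mult_ext1 //.
rewrite expr1n mulr1.
(* The block at [A] pairs the upper parameters of columns three and four with the lower ones of
   columns five and six; the block at [A^-1] does the reverse. *)
transitivity (n X / n 1 * (n (A * X) / n A) * (n (A^-1 * X) / n A^-1)).
  rewrite !big_ord_recl big_ord0 !(tnth_nth 0) /=.
  have chi4AV : (chi4 * A)^-1 = chi4^-1 * A^-1 by rewrite invrM // mulrC.
  rewrite -[phi / A * X]mulrA -[phi * A * X]mulrA !phiXV ?rpredM // phiV chi4AV.
  rewrite -[chi4 * A * X]mulrA -[chi4^-1 * A * X]mulrA -[chi4 / A * X]mulrA.
  rewrite -[chi4^-1 / A * X]mulrA /n !invr1 !mulr1 !mul1r !invfM; ring.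
rewrite !nE ?rpredM ?rpred1 // !exprMn expr1n h1 exprVn -hB.
have [hB0 hVB0] : h B != 0 /\ h B^-1 != 0.
  by move: q0; rewrite -hB mulf_eq0 negb_or => /andP[].
by field; rewrite nzk hB0 hVB0.
Qed.

End Evaluation.

Theorem corollary5p2 (F : finFieldType) (theta : F -> algC)
    (phi chi4 A : mult_classfun F) :
  (#|F| = 1 %[mod 4])%N ->
  nontrivial_additive_char theta ->
  phi \is a linear_char -> #[phi]%CF = 2%N ->
  chi4 \is a linear_char -> #[chi4]%CF = 4%N ->
  A \is a linear_char -> A ^+ 8 != 1 ->
  let g := gauss theta in
  hypergeometric theta
    [tuple chi4; chi4^-1; chi4 * A; chi4^-1 * A; chi4 * A^-1; (chi4 * A)^-1]
    [tuple 1; phi; A^-1; phi * A^-1; A; phi * A]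
    1
  = 1
    + \sum_(i : mult_Iirr F | 'chi_i ^+ 2 == phi)
        (let R := 'chi_i in
         g (R^-1 * phi * A ^+ 2) * g (R^-1 * phi * A^-1 ^+ 2) / g R^-1 ^+ 2)
    + (if #|F| == 1 %[mod 8] then
         \sum_(i : mult_Iirr F | 'chi_i ^+ 2 == chi4)
           (let S := 'chi_i in
            g (S * A) * g (chi4 * S * A)
            / (g (phi * S * A) * g (chi4^-1 * S * A)))
       else 0).
Proof.
move=> q4 theta_char lin_phi ord_phi lin_chi4 ord_chi4 linA ntA8 g.
have phi2 : phi ^+ 2 = 1 by rewrite -ord_phi exp_cforder.
have nt_phi : phi != 1.
  by rewrite -[phi]expr1 -dvdn_cforder ord_phi.
(* [chi4 ^+ 2] is nontrivial with square 1, and [phi] is the only such character. *)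
have chi4_sqr : chi4 ^+ 2 = phi.
  have chi44 : (chi4 ^+ 2) ^+ 2 = 1 by apply/eqP; rewrite -exprM -dvdn_cforder ord_chi4.
  have [] // := lin_char_sqr_eq1 lin_phi phi2 nt_phi (rpredX 2 lin_chi4) chi44.
  by move/eqP; rewrite -dvdn_cforder ord_chi4.
have phiN1 : mult_ext phi (-1) = 1.
  have nzN1 : -1 != 0 :> F by rewrite oppr_eq0 oner_eq0.
  by rewrite -chi4_sqr mult_extXl // -mult_extX // sqrrN expr1n mult_ext1.
rewrite (hypergeometric_triple_sum theta_char lin_phi phi2 nt_phi phiN1 lin_chi4
  chi4_sqr linA ntA8).
rewrite (triple_sum1_gauss theta_char lin_phi phi2 nt_phi phiN1 lin_chi4
  chi4_sqr linA ntA8 q4).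
rewrite (triple_sumN1_gauss theta_char lin_phi phi2 nt_phi phiN1 lin_chi4
  chi4_sqr linA ntA8).
rewrite -mulrDr mulrC mulKf ?natr_card_neq0 //.
by rewrite addrAC.
Qed.
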